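(* Let $\mathcal{H}$ be a real Hilbert space and let $f:\mathcal{H}\to\mathbb{R}$ be a convex function of class $\mathcal{C}^1$ such that $S:=\operatorname{argmin}_{\mathcal{H}} f\neq\emptyset$ and $\nabla f$ is Lipschitz continuous on every bounded subset of $\mathcal{H}$. Let $s_0>0$, $\lambda>0$, assume that $\alpha>1$, and let $x:[s_0,+\infty[\to\mathcal{H}$ be a solution trajectory of $$\begin{cases}\ddot x(s)+\dfrac{\alpha}{s}\dot x(s)+\dfrac{\alpha-1}{\lambda s}\dot w(s)+w(s)=0\\ w(s)=\nabla f\left(x(s)+\dfrac{s}{\alpha-1}\dot x(s)\right).\end{cases}$$ Then the following statements are true: (i) $\int_{s_0}^{+\infty}s^3\|w(s)\|^2ds<+\infty$; (ii) $\|w(s)\|=o\left(\frac1{s^2}\right)$ as $s\to+\infty$; (iii) $\|\dot x(s)\|=o\left(\frac1s\right)$ as $s\to+\infty$; (iv) $x(s)$ converges weakly as $s\to+\infty$, and its limit belongs to $S$. If $\alpha>3$, then (v) $f(x(s))-\inf_{\mathcal{H}}f=o\left(\frac1{s^2}\right)$ as $s\to+\infty$.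
   Context: A solution trajectory is understood in the strong sense: $x$ is of class $\mathcal{C}^1$ on $[s_0,+\infty[$, $\dot x$ is locally absolutely continuous (hence so is $w$), and the first equation holds for almost every $s\ge s_0$. *)

(* Defs.v *)
From HB Require Import structures.
From mathcomp Require Import all_boot all_order all_algebra.
From mathcomp Require Import sesquilinear.
From mathcomp Require Import all_classical all_reals all_analysis.
Import Order.TTheory GRing.Theory Num.Theory.
Import numFieldNormedType.Exports.

Set Implicit Arguments.
Unset Strict Implicit.
Unset Printing Implicit Defensive.

Local Open Scope classical_set_scope.
Local Open Scope ring_scope.

(* A real Hilbert space is a [completeNormedModType R], [R : realType], with
   [dot : {dot H for idfun}] (a symmetric positive definite bilinear form)
   inducing the norm: *)
Definition induces_norm (R : realType) (H : completeNormedModType R)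
    (dot : {dot H for idfun}) : Prop :=
  forall u : H, `|u| ^+ 2 = dot u u.

(* The second clause is continuity of [x |-> 'd f x] in the operator norm. *)
Definition class_C1 (R : realType) (V W : normedModType R) (f : V -> W) : Prop :=
  (forall x : V, differentiable f x) /\
  forall (x : V) (e : R), 0 < e ->
    \forall y \near x, forall h : V, `|'d f y h - 'd f x h| <= e * `|h|.

(* By the Riesz theorem, when [f] is differentiable at [x] there is exactly
   one such [g]; the value 0 is a dummy for the other points. *)
Definition gradient (R : realType) (H : completeNormedModType R)
    (dot : {dot H for idfun}) (f : H -> R) (x : H) : H :=
  xget 0 [set g : H | forall h : H, 'd f x h = dot g h].

Definition argmin (R : realType) (T : Type) (f : T -> R) : set T :=
  [set x | forall y, f x <= f y].

(* Makes the Landau notation [f =o_+oo g] available. *)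
Canonical pinfty_filter_on (R : numFieldType) : filter_on R :=
  FilterType (pinfty_nbhs R) _.

(* Convergence for the weak topology sigma(V, V^* ). *)
Definition weakly_cvg_to (R : realType) (V : normedModType R)
    (T : Type) (F : set_system T) (x : T -> V) (l : V) : Prop :=
  forall phi : {linear V -> R^o}, continuous phi ->
    phi (x t) @[t --> F] --> phi l.

(* The limit is restricted to [t \in D], [t != s], so that at an end point of
   an interval [D] this is the one-sided derivative. *)
Definition has_derivative_within (R : realType) (V : normedModType R)
    (D : set R) (x : R -> V) (s : R) (l : V) : Prop :=
  (t - s)^-1 *: (x t - x s) @[t --> within D s^'] --> l.

Definition absolutely_continuous_on (R : realType) (V : normedModType R)
    (a b : R) (u : R -> V) : Prop :=
  forall e : R, 0 < e -> exists2 d : R, 0 < d &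
    forall (n : nat) (l r : 'I_n -> R),
      (forall i, [/\ a <= l i, l i <= r i & r i <= b]) ->
      trivIset [set: 'I_n] (fun i => `]l i, r i[%classic) ->
      \sum_(i < n) (r i - l i) < d ->
      \sum_(i < n) `|u (r i) - u (l i)| < e.

Definition locally_absolutely_continuous_from (R : realType)
    (V : normedModType R) (s0 : R) (u : R -> V) : Prop :=
  forall a b : R, s0 <= a -> a <= b -> absolutely_continuous_on a b u.

(* Strong solutions on [s0, +oo[ ; [dx] is the derivative of [x] there, and
   values to the left of [s0] are irrelevant.  That [dx] and [w] are
   differentiable at almost every [s] is part of the last clause because
   ['D_1] is a dummy at points of non-differentiability. *)
Record strong_solution (R : realType) (H : completeNormedModType R)
    (dot : {dot H for idfun}) (f : H -> R) (s0 lambda alpha : R)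
    (x dx w : R -> H) : Prop := StrongSolution {
  strong_solution_derivative : forall s : R, s0 <= s ->
    has_derivative_within `[s0, +oo[%classic x s (dx s) ;
  strong_solution_continuous : {within `[s0, +oo[, continuous dx} ;
  strong_solution_ac : locally_absolutely_continuous_from s0 dx ;
  strong_solution_w : forall s : R, s0 <= s ->
    w s = gradient dot f (x s + (s / (alpha - 1)) *: dx s) ;
  strong_solution_ode :
    {ae @lebesgue_measure R, forall s : R, s0 <= s ->
      [/\ derivable dx s 1, derivable w s 1 &
          'D_1 dx s + (alpha / s) *: dx s
          + ((alpha - 1) / (lambda * s)) *: 'D_1 w s + w s = 0]} }.

(* Main.v *)
Require Import Defs.
From HB Require Import structures.
From mathcomp Require Import all_boot all_order all_algebra.
From mathcomp Require Import sesquilinear.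
From mathcomp Require Import all_classical all_reals all_analysis.
From mathcomp Require Import measurable_realfun ring lra.
Import Order.TTheory GRing.Theory Num.Theory.
Import numFieldNormedType.Exports.

(** Put [c = alpha - 1], [y = x + (s / c) x'] and [v = y + w / lambda], where
    [w = grad f (y)].  Multiplied by [s / c], the equation becomes of first
    order: [v' = - (s / c) w].  Since [y] is the proximal point of [v], [w] is
    the gradient at [v] of a Moreau envelope of [f]; so, in the time
    [s ^ 2 / (2 c)], [v] is a steepest descent curve of a convex function with
    the same minimisers as [f] and with Lipschitz gradient, and
    [x' = (c / s) (y - x)] makes [x] a weighted average of [y].

    The reduction ([strong_solution_newton_flow]) has to cope with an equation
    that holds almost everywhere only.  A mean value inequality for absolutely
    continuous curves ([absolutely_continuous_mean_value]) shows that [v] is of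
    class C1; afterwards no derivative of [x'] or [w] is used.

    Fix a minimiser [z], and let [F] be the envelope at [v] minus [f z].  Then
    [`|v - z|] decreases, and [s ^ 2 F + c `|v - z| ^ 2] has derivative at most
    [- (s ^ 3 / c) `|w| ^ 2], which gives the integral estimate
    ([flow_integral_lty]).  As [`|w|] also decreases, the same Lyapunov function
    between [s / 2] and [s] gives [`|w| = o(1 / s ^ 2)]
    ([flow_norm_w_rate]).

    The two other rates come from one differential inequality: if
    [s phi' <= - a phi + eta] with [a > 0] and [eta] tending to 0, then [phi]
    tends to 0 ([euler_inequality_cvg0]).  For [phi = `|x - v| ^ 2] this gives
    [x - v -> 0], hence [s x' = c (y - x) -> 0].  For
    [phi = s ^ 2 (f x - f z)], convexity gives it with [a = alpha - 3].

    The distance of [v] to every minimiser converges, so [v] converges weakly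
    by Opial's argument, and [x] has the same weak limit.  Asymptotic centres
    play the role of weak cluster points ([opial]): their existence, like the
    Riesz representation theorem, follows from the parallelogram law
    ([midpoint_convex_minimizer]). *)

Set Implicit Arguments.
Unset Strict Implicit.
Unset Printing Implicit Defensive.

Local Open Scope classical_set_scope.
Local Open Scope ring_scope.

(** * Inner products and strongly convex minimisation *)

Section inner_product.
Variables (R : realType) (H : completeNormedModType R).
Variables (dot : {dot H for idfun}) (hdot : induces_norm dot).
Implicit Types u v g h : H.

Lemma dotC u v : dot u v = dot v u.
Proof. by rewrite (hermC dot u v) /= expr0 mul1r. Qed.

Lemma dotDl u v g : dot (u + v) g = dot u g + dot v g.
Proof. exact: linearDl. Qed.

Lemma dotDr u v g : dot g (u + v) = dot g u + dot g v.
Proof. exact: linearDr. Qed.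

Lemma dotNl u g : dot (- u) g = - dot u g.
Proof. exact: linearNl. Qed.

Lemma dotNr u g : dot g (- u) = - dot g u.
Proof. exact: linearNr. Qed.

Lemma dotZl (a : R) u g : dot (a *: u) g = a * dot u g.
Proof. exact: linearZl_LR. Qed.

Lemma dotZr (a : R) u g : dot g (a *: u) = a * dot g u.
Proof. by rewrite dotC dotZl dotC. Qed.

Lemma dotBl u v g : dot (u - v) g = dot u g - dot v g.
Proof. by rewrite dotDl dotNl. Qed.

Lemma dotBr u v g : dot g (u - v) = dot g u - dot g v.
Proof. by rewrite dotDr dotNr. Qed.

Definition dotE := (dotBl, dotBr, dotDl, dotDr, dotNl, dotNr, dotZl, dotZr).

Lemma sqr_normD u v : `|u + v| ^+ 2 = `|u| ^+ 2 + 2 * dot u v + `|v| ^+ 2.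
Proof. by rewrite !hdot !dotE (dotC v u); ring. Qed.

Lemma sqr_normB u v : `|u - v| ^+ 2 = `|u| ^+ 2 - 2 * dot u v + `|v| ^+ 2.
Proof. by rewrite !hdot !dotE (dotC v u); ring. Qed.

(** The Cauchy-Schwarz inequality, from the squared distance of [v] to its
    projection on the line of [u]. *)
Lemma dot_le_norm u v : `|dot u v| <= `|u| * `|v|.
Proof.
rewrite -(@ler_pXn2r _ 2)// ?nnegrE ?mulr_ge0//.
rewrite exprMn !hdot real_normK ?num_real//.
have [->|u0] := eqVneq u 0; first by rewrite !linear0l expr0n.
have uu : 0 < dot u u by rewrite -hdot exprn_gt0// normr_gt0.
have := sqr_ge0 `|v - (dot u v / dot u u) *: u|.
rewrite hdot !dotE (dotC v u) -(pmulr_rge0 _ uu).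
rewrite -subr_ge0; congr (0 <= _).
by field; rewrite gt_eqF.
Qed.

Lemma dot_le u v : dot u v <= `|u| * `|v|.
Proof. exact: le_trans (ler_norm _) (dot_le_norm u v). Qed.

Lemma cvg_dot (T : Type) (F : set_system T) {FF : Filter F} (u v : T -> H) a b :
  u @ F --> a -> v @ F --> b -> dot (u t) (v t) @[t --> F] --> dot a b.
Proof.
move=> ua vb; apply/cvgrPdist_le => e e0.
pose d := Num.min 1 (e / (`|a| + `|b| + 1)).
have ab0 : 0 < `|a| + `|b| + 1 by rewrite ltr_wpDl// addr_ge0.
have d0 : 0 < d by rewrite lt_min ltr01 divr_gt0.
have de : d * (`|a| + `|b| + 1) <= e.
  by rewrite -ler_pdivlMr// ge_min lexx orbT.
have d1 : d <= 1 by rewrite ge_min lexx.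
move/cvgrPdist_le: ua => /(_ d d0) ua; move/cvgrPdist_le: vb => /(_ d d0) vb.
near=> t.
have hu : `|a - u t| <= d by near: t.
have hv : `|b - v t| <= d by near: t.
have -> : dot a b - dot (u t) (v t) =
    dot (a - u t) b + dot a (b - v t) - dot (a - u t) (b - v t).
  by rewrite !dotE; ring.
apply: le_trans de.
have h1 := dot_le_norm (a - u t) b.
have h2 := dot_le_norm a (b - v t).
have h3 := dot_le_norm (a - u t) (b - v t).
apply: le_trans (ler_normB _ _) _; rewrite mulrDr mulr1 mulrDr.
apply: lerD.
  rewrite [leRHS]addrC; apply: le_trans (ler_normD _ _) _; apply: lerD.
    by apply: le_trans h1 _; rewrite ler_wpM2r.
  by apply: le_trans h2 _; rewrite mulrC ler_wpM2r.
apply: le_trans h3 _; apply: le_trans (ler_pM _ _ hu hv) _ => //.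
by rewrite ger_pMr.
Unshelve. all: by end_near. Qed.

End inner_product.

(** The direct method for strongly convex functions, on an arbitrary set [E]
    that stands for an epigraph.  The gain [k * `|u - v| ^+ 2] at midpoints
    makes every minimising sequence Cauchy, so completeness gives a point
    which is approached together with the infimum, without any weak
    compactness.  No semicontinuity is built in: each application concludes
    with its own continuity.  It yields both the Riesz representation theorem
    and asymptotic centres. *)
Lemma midpoint_convex_minimizer (R : realType) (H : completeNormedModType R)
    (E : H -> R -> Prop) (k m : R) :
  0 < k -> (exists u r, E u r) -> (forall u r, E u r -> m <= r) ->
  (forall u v r s, E u r -> E v s ->
    E (2^-1 *: (u + v)) ((r + s) / 2 - k * `|u - v| ^+ 2)) ->
  exists l rho, (forall u r, E u r -> rho <= r) /\
    forall e, 0 < e -> exists u r, [/\ E u r, r < rho + e & `|u - l| < e].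
Proof.
move=> k0 [u0 [r0 Eur]] mE midE.
pose A := [set r | exists u, E u r].
have Ainf : has_inf A.
  split; first by exists r0, u0.
  by exists m => r [u /mE].
pose rho := inf A.
have rhoE u r : E u r -> rho <= r.
  by move=> ur; apply: ge_inf; [case: Ainf|exists u].
have near_rho e : 0 < e -> exists p : H * R, E p.1 p.2 /\ p.2 < rho + e.
  move=> e0; have [r [u ur] re] := inf_adherent e0 Ainf.
  by exists (u, r).
have /choice[p pP] : forall n : nat, exists p : H * R,
    E p.1 p.2 /\ p.2 < rho + n.+1%:R^-1.
  by move=> n; apply: near_rho; rewrite invr_gt0.
have diam n n' e : n.+1%:R^-1 <= e -> n'.+1%:R^-1 <= e ->
    k * `|(p n).1 - (p n').1| ^+ 2 <= e.
  move=> ne ne'; have [E1 l1] := pP n; have [E2 l2] := pP n'.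
  have := rhoE _ _ (midE _ _ _ _ E1 E2).
  have {}l1 := lt_le_trans l1 (lerD (lexx rho) ne).
  have {}l2 := lt_le_trans l2 (lerD (lexx rho) ne').
  set K := k * _; move: l1 l2; clearbody K; clear ne ne'; lra.
have pcauchy : cauchy ((fun n => (p n).1) @ \oo).
  apply/cauchy_ballP => e e0.
  have ke0 : 0 < k * (e / 2) ^+ 2 by rewrite mulr_gt0// exprn_gt0// divr_gt0.
  have [N HN] : exists N, forall n, (N <= n)%N -> n.+1%:R^-1 <= k * (e / 2) ^+ 2.
    have /cvgrPdist_le/(_ _ ke0)[N _ HN] := @cvg_harmonic R.
    exists N => n /HN; rewrite /= sub0r normrN ger0_norm// invr_ge0//.
  pose tail := [set (p n).1 | n in [set n | (N <= n)%N]].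
  exists (tail, tail) => /=.
    by split; (exists N => // n Nn /=; exists n).
  move=> [a b] [/= [n Nn <-] [n' Nn' <-]]; rewrite -ball_normE /=.
  have e20 : 0 <= e / 2 by rewrite divr_ge0// ltW.
  have := diam n n' _ (HN _ Nn) (HN _ Nn').
  rewrite ler_pM2l// ler_pXn2r ?nnegrE// => /le_lt_trans; apply.
  by rewrite gtr_pMr// invf_lt1// ltr1n.
have /cauchy_cvg pl := pcauchy.
exists (lim ((fun n => (p n).1) @ \oo)), rho; split => // e e0.
have ne : \forall n \near \oo, `|(p n).1 - lim ((fun n => (p n).1) @ \oo)| < e.
  by move/cvgrPdistC_lt : pl => /(_ e e0).
have ne' : \forall n \near \oo, n.+1%:R^-1 < e.
  have /cvgrPdist_lt/(_ _ e0)[N _ HN] := @cvg_harmonic R.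
  by exists N => // n /HN; rewrite /= sub0r normrN ger0_norm// invr_ge0//.
have [n [h1 h2]] := @filter_ex _ _ _ _ (filterI ne ne').
exists (p n).1, (p n).2; have [h3 h4] := pP n; split => //.
by rewrite (lt_trans h4)// ltrD2l.
Qed.

Section riesz.
Variables (R : realType) (H : completeNormedModType R).
Variables (dot : {dot H for idfun}) (hdot : induces_norm dot).

Lemma sqr_norm_midpoint (u v : H) :
  `|2^-1 *: (u + v)| ^+ 2 = (`|u| ^+ 2 + `|v| ^+ 2) / 2 - 4^-1 * `|u - v| ^+ 2.
Proof. by rewrite !hdot !dotE (dotC dot v u); field. Qed.

(** The vector that represents [phi] minimises [`|u| ^+ 2 - 2 * phi u], whose
    first-order condition is [dot l h = phi h]. *)
Lemma riesz_representation (phi : {linear H -> R^o}) :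
  continuous phi -> exists g, forall h, phi h = dot g h.
Proof.
move=> cphi; have [C C0 phiC] := linear_lipschitz cphi.
have phi_le u : phi u <= C * `|u| by apply: le_trans (ler_norm _) (phiC u).
have phiZ a u : phi (a *: u) = a * phi u by exact: linearZ.
have phiD u v : phi (u + v) = phi u + phi v by exact: linearD.
pose E u r := `|u| ^+ 2 - 2 * phi u <= r.
have [||||l [rho [rhoE lE]]] := @midpoint_convex_minimizer R H E 4^-1 (- C ^+ 2).
- by [].
- by exists 0, 0; rewrite /E linear0 normr0 expr0n mulr0 subrr.
- move=> u r; apply: le_trans; have := phi_le u; have := sqr_ge0 (`|u| - C).
  lra.
- move=> u v r s; rewrite /E sqr_norm_midpoint phiZ phiD.
  lra.
have lmin : `|l| ^+ 2 - 2 * phi l <= rho.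
  apply/ler_addgt0Pl => e e0.
  have cl : (fun u : H => `|u| ^+ 2 - 2 * phi u) @ l --> `|l| ^+ 2 - 2 * phi l.
    apply: cvgB; first by rewrite expr2; under eq_fun do rewrite expr2;
      apply: cvgM; apply: cvg_norm; exact: cvg_id.
    by apply: cvgM; [exact: cvg_cst|exact: cphi].
  have /nbhs_ballP[d /= d0 hd] : \forall u \near l,
      `|l| ^+ 2 - 2 * phi l - (`|u| ^+ 2 - 2 * phi u) <= e / 2.
    near=> u; apply: le_trans (ler_norm _) _.
    by near: u; move/cvgrPdist_le : cl; apply; rewrite divr_gt0.
  have ed0 : 0 < Num.min d (e / 2) by rewrite lt_min d0 divr_gt0.
  have [u [r [ur rl ul]]] := lE _ ed0.
  have := hd u; rewrite -ball_normE /= distrC => /(_ (lt_le_trans ul _)).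
  rewrite ge_min lexx => /(_ isT).
  have : Num.min d (e / 2) <= e / 2 by rewrite ge_min lexx orbT.
  move: ur rl; rewrite /E; lra.
exists l => h.
have key (t : R) : 0 <= t ^+ 2 * `|h| ^+ 2 + 2 * t * (dot l h - phi h).
  have := rhoE (l + t *: h) _ (lexx _); move: lmin.
  rewrite (sqr_normD hdot) normrZ exprMn real_normK ?num_real// !dotE.
  rewrite phiD phiZ; lra.
apply/eqP; rewrite eq_sym -subr_eq0; apply/eqP.
set a := dot l h - phi h in key *.
have q0 : 0 < `|h| ^+ 2 + 1 by rewrite ltr_wpDl// exprn_ge0.
(* A negative multiple of [a] small enough that the linear term dominates. *)
have := key (- a / (`|h| ^+ 2 + 1)).
have -> : (- a / (`|h| ^+ 2 + 1)) ^+ 2 * `|h| ^+ 2 +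
    2 * (- a / (`|h| ^+ 2 + 1)) * a =
   - (a ^+ 2 * (`|h| ^+ 2 + 2) / (`|h| ^+ 2 + 1) ^+ 2) by field; rewrite gt_eqF.
rewrite oppr_ge0 pmulr_lle0 ?invr_gt0 ?exprn_gt0// pmulr_lle0 ?ltr_wpDl ?exprn_ge0//.
by move=> a0; apply/eqP; rewrite -sqrf_eq0 eq_le a0 sqr_ge0.
Unshelve. all: by end_near. Qed.

End riesz.

(** * Derivatives of curves and gradients *)

Section derivative_of_curves.
Variables (R : realType) (V : normedModType R).
Implicit Types (u : R -> V) (s : R) (l : V).

Lemma is_derive1_cvgP u s l :
  is_derive s 1 u l <-> h^-1 *: (u (s + h) - u s) @[h --> 0^'] --> l.
Proof.
have E : (fun h => h^-1 *: ((u \o shift s) (h *: (1 : R)) - u s)) =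
         (fun h => h^-1 *: (u (s + h) - u s)).
  by apply/funext => h /=; rewrite [h *: _]mulr1 (addrC h s).
split=> [[du <-]|ul].
  by move: du; rewrite /derivable /derive E.
by split; [rewrite /derivable E; apply/cvg_ex; exists l|rewrite /derive E; exact: cvg_lim].
Qed.

(** The epsilon-delta form of differentiability: it is what gauge arguments
    and squeeze arguments need, and it avoids dividing by [t - s]. *)
Lemma is_derive1_estimateP u s l :
  is_derive s 1 u l <-> forall e, 0 < e -> exists2 d, 0 < d &
    forall t, `|t - s| < d -> `|u t - u s - (t - s) *: l| <= e * `|t - s|.
Proof.
have scal (h : R) (a : V) : h != 0 -> `|h^-1 *: a - l| = `|h|^-1 * `|a - h *: l|.
  by move=> h0; rewrite -normfV -normrZ scalerBr scalerK.
rewrite is_derive1_cvgP; split=> [ul e e0|ul].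
  move/cvgrPdistC_le: ul => /(_ e e0); rewrite -nbhs_nearE /= => -[d /= d0 hd].
  exists d => // t td; have [->|ts] := eqVneq t s.
    by rewrite !subrr scale0r subrr !normr0 mulr0.
  have ts0 : t - s != 0 by rewrite subr_eq0.
  have := hd (t - s); rewrite /= sub0r normrN => /(_ td ts0).
  by rewrite scal// subrKC ler_pdivrMl ?normr_gt0// mulrC.
apply/cvgrPdistC_le => e e0; have [d d0 hd] := ul e e0.
exists d => //= h; rewrite /= sub0r normrN => hd0 h0.
have := hd (s + h); rewrite addrAC subrr add0r => /(_ hd0).
by rewrite scal// ler_pdivrMl ?normr_gt0// mulrC.
Qed.

Lemma is_derive1_continuous u s l : is_derive s 1 u l -> u t @[t --> s] --> u s.
Proof.
by move=> [du _]; apply: differentiable_continuous; apply/derivable1_diffP.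
Qed.

Lemma is_derive1_continuous_shift u s l :
  is_derive s 1 u l -> u (s + h) @[h --> 0^'] --> u s.
Proof.
move=> /is_derive1_continuous cu.
have cu0 : u (s + h) @[h --> 0] --> u s.
  apply: (@cvg_comp _ _ _ (fun h => s + h) u _ (nbhs s)) cu.
  by rewrite -{2}(addr0 s); apply: cvgD; [exact: cvg_cst|exact: cvg_id].
exact: cvg_within_filter.
Qed.

Lemma is_derive1_scale_id u s l :
  is_derive s 1 u l -> is_derive s 1 (fun t => t *: u t) (u s + s *: l).
Proof.
move=> du; have us := is_derive1_continuous_shift du.
move: du; rewrite !is_derive1_cvgP => ul.
have cs : s @[_ --> (0 : R)^'] --> s by exact: cvg_cst.
apply: cvg_trans (cvgD us (cvgZ cs ul)); apply: near_eq_cvg.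
near=> h; have h0 : h != 0 by near: h; exact: nbhs_dnbhs_neq.
have E : u (s + h) + s *: (h^-1 *: (u (s + h) - u s)) =
    h^-1 *: ((s + h) *: u (s + h) - s *: u s).
  rewrite scalerA mulrC -scalerA -[X in X + _](scalerK h0) -scalerDr.
  by congr (_ *: _); rewrite scalerDl scalerBr addrCA addrA.
exact: E.
Unshelve. all: by end_near. Qed.

Lemma is_derive1_line (y h : V) s : is_derive s 1 (fun t : R => y + t *: h) h.
Proof.
apply/is_derive1_estimateP => e e0; exists 1 => // t _.
rewrite opprD addrACA subrr add0r -scalerBl subrr normr0.
by rewrite mulr_ge0// ltW.
Qed.

End derivative_of_curves.

Lemma cvg_sqr_norm (R : realType) (V : normedModType R) (T : Type)
    (F : set_system T) {FF : Filter F} (u : T -> V) (l : V) :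
  u @ F --> l -> `|u t| ^+ 2 @[t --> F] --> `|l| ^+ 2.
Proof. by move=> ul; exact: (cvgM (cvg_norm ul) (cvg_norm ul)). Qed.

Section hilbert_calculus.
Variables (R : realType) (H : completeNormedModType R).
Variables (dot : {dot H for idfun}) (hdot : induces_norm dot).
Implicit Types (u v : R -> H) (f : H -> R) (s : R) (y z h : H).

Lemma is_derive1_dot u v s (du dv : H) : is_derive s 1 u du -> is_derive s 1 v dv ->
  is_derive s 1 (fun t => dot (u t) (v t)) (dot du (v s) + dot (u s) dv).
Proof.
move=> hu hv; have vs := is_derive1_continuous_shift hv.
move: hu hv; rewrite !is_derive1_cvgP => ul vl.
apply: cvg_trans (cvgD (cvg_dot hdot ul vs) (cvg_dot hdot (cvg_cst (u s)) vl)).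
apply: near_eq_cvg; near=> h.
have E : dot (h^-1 *: (u (s + h) - u s)) (v (s + h)) +
    dot (u s) (h^-1 *: (v (s + h) - v s)) =
    h^-1 * (dot (u (s + h)) (v (s + h)) - dot (u s) (v s)).
  by rewrite !dotE; ring.
exact: E.
Unshelve. all: by end_near. Qed.

Lemma is_derive1_sqr_norm u s du : is_derive s 1 u du ->
  is_derive s 1 (fun t => `|u t| ^+ 2) (2 * dot (u s) du).
Proof.
move=> hu; have := is_derive1_dot hu hu.
have -> : (fun t => dot (u t) (u t)) = (fun t => `|u t| ^+ 2).
  by apply/funext => t; rewrite hdot.
by rewrite (dotC dot du) mulr2n mulrDl !mul1r.
Qed.

(** The set in the definition of [gradient] is inhabited, by Riesz: the
    default value is never taken at points of differentiability. *)
Lemma gradientP f y : differentiable f y ->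
  forall h, 'd f y h = dot (gradient dot f y) h.
Proof.
move=> dfy; apply: (@xgetPex _ 0 [set g : H | forall h : H, 'd f y h = dot g h]).
by apply: riesz_representation => //; exact: diff_continuous.
Qed.

Lemma is_derive1_comp_gradient f u s du :
  differentiable f (u s) -> is_derive s 1 u du ->
  is_derive s 1 (f \o u) (dot (gradient dot f (u s)) du).
Proof.
move=> df [hu uE]; have du' : differentiable u s by apply/derivable1_diffP.
have dfu : differentiable (f \o u) s by exact: differentiable_comp.
split; first exact/derivable1_diffP.
have us : 'd u s 1 = du by rewrite -deriveE.
by rewrite deriveE// diff_comp//= us; exact: gradientP.
Qed.

Lemma gradient_quotient f y h : differentiable f y ->
  t^-1 * (f (y + t *: h) - f y) @[t --> 0^'+] --> dot (gradient dot f y) h.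
Proof.
move=> dfy; have dl := is_derive1_line y h 0.
have dfy' : differentiable f (y + 0 *: h) by rewrite scale0r addr0.
have := is_derive1_comp_gradient dfy' dl.
rewrite is_derive1_cvgP /= scale0r addr0 => q.
have E : (fun t => t^-1 *: (f (y + (0 + t) *: h) - f y)) =
    (fun t => t^-1 * (f (y + t *: h) - f y)).
  by apply/funext => t; rewrite add0r.
by rewrite E in q; exact: cvg_dnbhs_at_right q.
Qed.

(** The difference quotients of [f] from [y] towards [z] are at most
    [f z - f y] by convexity; let the step tend to 0. *)
Lemma convex_gradient_le f y z : convex_function setT f -> differentiable f y ->
  f y + dot (gradient dot f y) (z - y) <= f z.
Proof.
move=> cf dfy; rewrite -lerBrDl.
have q := @gradient_quotient f y (z - y) dfy.
apply: (cvgr_to_le q); near=> t.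
have t0 : 0 < t by near: t; exact: nbhs_right_gt.
have t1 : t <= 1 by near: t; exact: nbhs_right_le.
rewrite ler_pdivrMl//.
pose t01 : {i01 R} := Itv01 (ltW t0) t1.
have h : f (t *: z + (1 - t) *: y) <= t * f z + (1 - t) * f y.
  exact: cf t01 z y (mem_setT _) (mem_setT _).
have -> : y + t *: (z - y) = t *: z + (1 - t) *: y.
  by rewrite scalerBl scale1r scalerBr addrCA addrA addrAC.
lra.
Unshelve. all: by end_near. Qed.

End hilbert_calculus.

(** * A mean value inequality for absolutely continuous curves *)

(** Real induction: the set of points of [[a, b]] where [P] holds has a
    supremum, and the step around that supremum pushes past it unless it is
    [b].  This replaces the compactness of [[a, b]] in Cousin's lemma. *)
Lemma interval_induction (R : realType) (P : R -> Prop) (a b : R) :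
  a <= b -> P a ->
  (forall t, a <= t <= b -> exists2 d, 0 < d & forall p q,
    a <= p -> p <= t -> t <= q -> q <= b -> q - p < d -> P p -> P q) ->
  P b.
Proof.
move=> ab Pa step; pose A := [set t | a <= t <= b /\ P t].
have Aa : A a by split; rewrite ?lexx.
have ubA : has_ubound A by exists b => t [/andP[]].
have supA : has_sup A by split => //; exists a.
have aT : a <= sup A by exact: ub_le_sup.
have Tb : sup A <= b by apply: ge_sup; [exists a|move=> t [/andP[]]].
have [|d d0 hd] := step (sup A); first by rewrite aT Tb.
have d20 : 0 < d / 2 by rewrite divr_gt0.
have [p [/andP[ap pb] Pp] pT] := sup_adherent d20 supA.
have pleT : p <= sup A by apply: ub_le_sup => //; split; rewrite ?ap ?pb.
pose q := Num.min b (sup A + d / 4).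
have qb : q <= b by rewrite ge_min lexx.
have Tq : sup A <= q by rewrite le_min Tb lerDl divr_ge0// ltW.
have qT : q <= sup A + d / 4 by rewrite ge_min lexx orbT.
have Pq : P q by apply: (hd p q) => //; lra.
have : q <= sup A by apply: ub_le_sup => //; split => //; rewrite (le_trans aT Tq).
rewrite /q ge_min => /orP[bT|]; last by rewrite gerDl leNgt divr_gt0.
by have /eqP <- : q == b by rewrite eq_le qb (le_trans bT Tq).
Qed.

Section mean_value_inequality.
Variables (R : realType) (V : normedModType R).
Implicit Types (u : R -> V) (a b K : R) (U : set R).

(** A gauge splits [[a, b]] into intervals on which [u] has slope at most [K]
    and intervals included in [U].  Only the latter are recorded, because the
    former contribute at most [K * (b - a)] altogether. *)
Lemma gauge_partition u K U a b : a <= b -> 0 <= K ->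
  (forall t, a <= t <= b -> exists2 d, 0 < d & forall p q,
    a <= p -> p <= t -> t <= q -> q <= b -> q - p < d ->
    `|u q - u p| <= K * (q - p) \/ `]p, q[%classic `<=` U) ->
  exists (n : nat) (l r : 'I_n -> R),
    [/\ forall i, [/\ a <= l i, l i <= r i & r i <= b],
        trivIset [set: 'I_n] (fun i => `]l i, r i[%classic),
        forall i, `]l i, r i[%classic `<=` U &
        `|u b - u a| <= K * (b - a) + \sum_(i < n) `|u (r i) - u (l i)|].
Proof.
move=> ab K0 step.
pose P t := exists (n : nat) (l r : nat -> R),
  [/\ forall i, (i < n)%N -> [/\ a <= l i, l i <= r i, r i <= t &
                             `]l i, r i[%classic `<=` U],
      forall i j, (i < j < n)%N -> r i <= l j &
      `|u t - u a| <= K * (t - a) + \sum_(i < n) `|u (r i) - u (l i)|].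
have : P b.
  apply: (interval_induction ab).
    exists 0%N, (fun=> 0), (fun=> 0); split => [//|i j /andP[]//|].
    by rewrite big_ord0 !subrr normr0 mulr0 addr0.
  move=> t tab; have [d d0 hd] := step t tab.
  exists d => // p q ap pt tq qb qpd [n [l [r [lr ord up]]]].
  have pq := le_trans pt tq.
  have tri : `|u q - u a| <= `|u q - u p| + `|u p - u a|.
    by rewrite -(subrKA (u p) (u q)) ler_normD.
  have [good|bad] := hd _ _ ap pt tq qb qpd.
    exists n, l, r; split => //.
      by move=> i /lr[? ? rp ?]; split=> //; exact: le_trans pq.
    by apply: le_trans tri _; move: up good; lra.
  (* A step inside [U] is recorded after the earlier ones. *)
  exists n.+1, (fun i => if (i < n)%N then l i else p),
               (fun i => if (i < n)%N then r i else q); split.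
  - move=> i; rewrite ltnS leq_eqVlt => /orP[/eqP->|iN].
      by rewrite ltnn.
    by have [? ? rp ?] := lr _ iN; rewrite iN; split=> //; exact: le_trans pq.
  - move=> i j /andP[ij]; rewrite ltnS leq_eqVlt => /orP[/eqP jE|jN].
      by rewrite jE ltnn -jE ij; have [] := lr i; rewrite -?jE.
    by rewrite jN (ltn_trans ij jN) ord// ij.
  - rewrite big_ord_recr /= ltnn.
    under eq_bigr => i _ do rewrite ltn_ord.
    apply: le_trans tri _; have := ler_wpM2l K0 (lerB pq (lexx a)).
    move: up; lra.
move=> [n [l [r [lr ord ub]]]].
exists n, (fun i => l i), (fun i => r i); split => //.
- by move=> i; have [] := lr _ (ltn_ord i).
- apply/trivIsetP => i j _ _ ij; rewrite -subset0 => x [/=].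
  rewrite !in_itv /= => /andP[x1 x2] /andP[x3 x4].
  have [ji|ji|/val_inj ji] := ltngtP i j; last by rewrite ji eqxx in ij.
    have := ord i j; rewrite ji ltn_ord => /(_ isT); lra.
  have := ord j i; rewrite ji ltn_ord => /(_ isT); lra.
- by move=> i; have [] := lr _ (ltn_ord i).
Qed.

(** Evaluating on both sides of the tag [t] keeps the error proportional to
    [q - p]. *)
Lemma straddle u (l : V) e t p q : p <= t <= q ->
  `|u p - u t - (p - t) *: l| <= e * `|p - t| ->
  `|u q - u t - (q - t) *: l| <= e * `|q - t| ->
  `|u q - u p| <= (`|l| + e) * (q - p).
Proof.
move=> /andP[pt tq] hp hq.
have -> : u q - u p = (u q - u t - (q - t) *: l) - (u p - u t - (p - t) *: l)
   + (q - p) *: l.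
  have -> : q - p = (q - t) - (p - t) by ring.
  rewrite [((q - t) - _) *: _]scalerBl.
  rewrite [in RHS]opprB addrC -addrA [X in _ - _ + X]addrC !addrA.
  by rewrite !subrK opprB addrA subrK addrC.
apply: le_trans (ler_normD _ _) _; rewrite mulrDl addrC normrZ.
have qp : 0 <= q - p by rewrite subr_ge0 (le_trans pt).
rewrite ger0_norm// mulrC lerD2l.
apply: le_trans (ler_normB _ _) _; apply: le_trans (lerD hq hp) _.
by rewrite ger0_norm ?subr_ge0// distrC ger0_norm ?subr_ge0// -mulrDr subrKA.
Qed.

Lemma sum_lengths_le (n : nat) (l r : 'I_n -> R) U :
  open U -> (forall i, l i <= r i) ->
  trivIset [set: 'I_n] (fun i => `]l i, r i[%classic) ->
  (forall i, `]l i, r i[%classic `<=` U) ->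
  ((\sum_(i < n) (r i - l i))%:E <= @lebesgue_measure R U)%E.
Proof.
move=> oU lr tI sub.
rewrite -sumEFin.
have -> : (\sum_(i < n) (r i - l i)%:E)%E =
          (\sum_(i < n) @lebesgue_measure R `]l i, r i[%classic)%E.
  apply: eq_bigr => i _; rewrite lebesgue_measure_itv /= lte_fin EFinB.
  case: ltP => // rl; have -> : l i = r i by apply/eqP; rewrite eq_le lr rl.
  by rewrite subee.
rewrite -measure_bigsetU_ord//; apply: le_measure; rewrite ?inE.
- by apply: bigsetU_measurable => i _; exact: measurable_itv.
- exact: open_measurable.
- by apply: (big_ind (fun A => A `<=` U)) => // A B AU BU; rewrite subUset.
Qed.

(** The null set where the derivative bound fails is covered by an open set
    [U] of measure less than the modulus of absolute continuity.  Tags in the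
    null set give intervals included in [U], whose total variation is less
    than [e]; the other tags give intervals of slope at most [M + e].  This
    needs no integration of vector-valued functions. *)
Theorem absolutely_continuous_mean_value u a b (M : R) :
  a <= b -> 0 <= M -> absolutely_continuous_on a b u ->
  {ae @lebesgue_measure R, forall s, a <= s <= b ->
     exists2 l, is_derive s 1 u l & `|l| <= M} ->
  `|u b - u a| <= M * (b - a).
Proof.
move=> ab M0 uAC [N [mN N0 subN]].
suff main e : 0 < e -> `|u b - u a| <= (M + e) * (b - a) + e.
  apply/ler_addgt0Pl => e e0.
  have c0 : 0 < b - a + 1 by rewrite ltr_wpDl// subr_ge0.
  have := main (e / (b - a + 1)) (divr_gt0 e0 c0).
  rewrite mulrDl -addrA -{2}[e / _]mulr1 -mulrDr divfK ?gt_eqF//; by rewrite addrC.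
move=> e0; have [d d0 hd] := uAC e e0.
have [|U [oU NU mU]] := @lebesgue_regularity_outer R N d mN _ d0.
  by rewrite [ltLHS]N0.
have {}mU : (@lebesgue_measure R U < d%:E)%E.
  apply: le_lt_trans mU; rewrite -[leRHS]adde0 -[X in (_ + X)%E]N0.
  have mU := open_measurable oU.
  apply: le_trans (measureU2 _ _ _) => //; last exact: measurableD.
  apply: le_measure; rewrite ?inE//; first by apply: measurableU => //; exact: measurableD.
  by rewrite setUC setDUK.
have [|||n [l [r [lr tI sub ub]]]] := @gauge_partition u (M + e) U a b => //.
- by rewrite addr_ge0// ltW.
- move=> t tab; have [Nt|Nt] := pselect (N t).
    have /nbhs_ballP[g /= g0 hg] := open_nbhs_nbhs (conj oU (NU _ Nt)).
    exists g => // p q ap pt tq qb qp; right => x /=; rewrite in_itv /= => /andP[px xq].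
    by apply: hg; rewrite -ball_normE /= ltr_norml; lra.
  have [k uk kM] : exists2 l, is_derive t 1 u l & `|l| <= M.
    by apply: contrapT => h; apply: Nt; apply: subN => /= /(_ tab).
  have [g g0 hg] := (is_derive1_estimateP _ _ _).1 uk e e0.
  exists g => // p q ap pt tq qb qp; left.
  apply: le_trans (@straddle _ _ e _ _ _ _ (hg p _) (hg q _)) _.
  - by rewrite pt tq.
  - by rewrite ltr_norml; lra.
  - by rewrite ltr_norml; lra.
  - by rewrite ler_wpM2r ?lerD2r ?subr_ge0 ?(le_trans pt tq).
apply: le_trans ub _; rewrite lerD2l ltW//; apply: hd => //.
rewrite -lte_fin; apply: le_lt_trans mU; apply: sum_lengths_le => // i.
by have [] := lr i.
Qed.

End mean_value_inequality.

(** * From almost everywhere to everywhere derivatives *)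

Section absolutely_continuous_curves.
Variables (R : realType).

Lemma absolutely_continuous_dominated (V W : normedModType R) (u : R -> V)
    (u' : R -> W) (a b A B : R) : 0 <= A -> 0 <= B ->
  absolutely_continuous_on a b u ->
  (forall p q, a <= p -> p <= q -> q <= b ->
     `|u' q - u' p| <= A * `|u q - u p| + B * (q - p)) ->
  absolutely_continuous_on a b u'.
Proof.
move=> A0 B0 uAC u'u e e0.
have A1 : 0 < A + 1 by rewrite ltr_wpDl.
have B1 : 0 < B + 1 by rewrite ltr_wpDl.
have [d d0 hd] :=
  uAC (e / 2 / (A + 1)) (divr_gt0 (divr_gt0 e0 (ltr0Sn _ _)) A1).
exists (Num.min d (e / 2 / (B + 1))); first by rewrite lt_min d0 !divr_gt0.
move=> n l r lr tI; rewrite lt_min => /andP[/(hd _ _ _ lr tI) h1 h2].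
apply: (@le_lt_trans _ _
  (\sum_(i < n) (A * `|u (r i) - u (l i)| + B * (r i - l i)))).
  by apply: ler_sum => i _; have [la lri rb] := lr i; exact: u'u.
rewrite big_split /= -!mulr_sumr.
have s1 : 0 <= \sum_(i < n) `|u (r i) - u (l i)| by apply: sumr_ge0.
have s2 : 0 <= \sum_(i < n) (r i - l i).
  by apply: sumr_ge0 => i _; have [_ lri _] := lr i; rewrite subr_ge0.
move: h1 h2; rewrite !ltr_pdivlMr// => h1 h2; lra.
Qed.

(** Near [t] the curve [u z - (z - t) *: g t] is absolutely continuous with a
    derivative [g z - g t] that is almost everywhere small, so it is Lipschitz
    with a small constant. *)
Lemma absolutely_continuous_is_derive (V : normedModType R) (u g : R -> V)
    (s0 t : R) : s0 < t ->
  (forall a b, s0 < a -> a <= b -> absolutely_continuous_on a b u) ->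
  {ae @lebesgue_measure R, forall s, s0 < s -> is_derive s 1 u (g s)} ->
  {for t, continuous g} -> is_derive t 1 u (g t).
Proof.
move=> s0t uAC ug cg; apply/is_derive1_estimateP => e e0.
have /cvgrPdistC_le/(_ e e0) := cg.
move=> /nbhs_ballP[d /= d0 hd].
exists (Num.min d (t - s0)); first by rewrite lt_min d0 subr_gt0.
move=> r; rewrite lt_min => /andP[rd rs].
pose v z := u z - (z - t) *: g t.
suff vL a b : s0 < a -> a <= b -> (forall s, a <= s <= b -> `|s - t| < d) ->
    `|v b - v a| <= e * (b - a).
  have vt : v t = u t by rewrite /v subrr scale0r subr0.
  have -> : u r - u t - (r - t) *: g t = v r - v t by rewrite vt /v addrAC.
  have [rt|tr] := leP r t.
    rewrite distrC [`|r - t|]distrC [`|t - r|]ger0_norm ?subr_ge0//.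
    apply: vL => //; first by move: rs; rewrite ltr_norml; lra.
    by move=> s rst; move: rd; rewrite !ltr_norml; lra.
  rewrite [`|r - t|]ger0_norm ?subr_ge0 ?(ltW tr)//.
  apply: vL => //; first exact: ltW.
  by move=> s rst; move: rd; rewrite !ltr_norml; lra.
move=> s0a ab abd; apply: absolutely_continuous_mean_value => //; first exact: ltW.
  apply: (@absolutely_continuous_dominated _ _ u _ _ _ 1 `|g t|) => //; first exact: uAC.
  move=> p q ap pq qb; rewrite mul1r.
  have -> : v q - v p = u q - u p - (q - p) *: g t.
    have -> : q - p = (q - t) - (p - t) by ring.
    by rewrite [(_ - _ - _) *: _]scalerBl /v !opprD addrACA.
  apply: le_trans (ler_normB _ _) _.
  by rewrite normrZ [`|q - p|]ger0_norm ?subr_ge0// mulrC.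
case: ug => N [mN N0 subN]; exists N; split=> // s /= nus; apply: subN => /= us.
apply: nus => /andP[as_ sb].
exists (g s - g t); last first.
  by apply: (hd s); rewrite -ball_normE /= distrC; apply: abd; rewrite as_ sb.
have du := us (lt_le_trans s0a as_).
have -> : v = (fun z => u z - (- (t *: g t) + z *: g t)).
  by apply/funext => z; rewrite /v scalerBl [- _ + _]addrC.
have dl := is_derive1_line (- (t *: g t)) (g t) s.
exact: (@is_deriveB _ _ _ u _ s 1 _ _ du dl).
Qed.

End absolutely_continuous_curves.

(** * One-sided derivatives and Lipschitz bounds *)

Section one_sided_curves.
Variables (R : realType) (V : normedModType R).
Implicit Types (u : R -> V) (s : R).

Lemma has_derivative_within_estimate (D : set R) u s l :
  has_derivative_within D u s l -> forall e, 0 < e -> exists2 d, 0 < d &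
    forall t, D t -> `|t - s| < d -> `|u t - u s - (t - s) *: l| <= e * `|t - s|.
Proof.
move=> /cvgrPdistC_le ul e e0; have := ul e e0.
rewrite -nbhs_nearE /within /= /dnbhs /within /= => -[d /= d0 hd].
exists d => // t Dt td; have [->|ts] := eqVneq t s.
  by rewrite !subrr scale0r subrr !normr0 mulr0.
have ts0 : t - s != 0 by rewrite subr_eq0.
have := hd t; rewrite /= distrC => /(_ td ts Dt).
by rewrite -[X in `|_ - X|](scalerK ts0) -scalerBr normrZ normfV
  ler_pdivrMl ?normr_gt0// mulrC.
Qed.

Lemma has_derivative_within_ray (s0 : R) u s l : s0 < s ->
  has_derivative_within `[s0, +oo[%classic u s l -> is_derive s 1 u l.
Proof.
move=> s0s ul; apply/is_derive1_estimateP => e e0.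
have [d d0 hd] := has_derivative_within_estimate ul e0.
exists (Num.min d (s - s0)); first by rewrite lt_min d0 subr_gt0.
move=> t; rewrite lt_min => /andP[td ts]; apply: hd => //=.
by rewrite in_itv /= andbT; move: ts; rewrite ltr_norml; lra.
Qed.

Lemma has_derivative_within_continuous (s0 : R) u (du : R -> V) :
  (forall s, s0 <= s -> has_derivative_within `[s0, +oo[%classic u s (du s)) ->
  {within `[s0, +oo[, continuous u}.
Proof.
move=> hu; apply/subspace_continuousP => s /= s0s.
have {}s0s : s0 <= s by move: s0s; rewrite in_itv /= andbT.
apply/cvgrPdistC_le => e e0.
have [d d0 hd] := has_derivative_within_estimate (hu s s0s) ltr01.
have c0 : 0 < 1 + `|du s| by rewrite ltr_pwDl.
have m0 : 0 < Num.min d (e / (1 + `|du s|)) by rewrite lt_min d0 divr_gt0.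
exists (Num.min d (e / (1 + `|du s|))) => //= t /=; rewrite distrC lt_min => /andP[td te] Dt.
have := hd t Dt td; rewrite mul1r => h.
rewrite -(subrK ((t - s) *: du s) (u t - u s)).
apply: le_trans (ler_normD _ _) _; rewrite normrZ.
move: te; rewrite ltr_pdivlMr// => te.
by apply: le_trans (ltW te); rewrite mulrDr mulr1 lerD2r.
Qed.

(** Freezing a curve to the left of [s0] removes the end point: a curve that
    is continuous on the half-line becomes continuous on [R]. *)
Lemma continuous_clamp (s0 : R) u :
  {within `[s0, +oo[, continuous u} -> continuous (fun s => u (Num.max s s0)).
Proof.
move=> /subspace_continuousP cu s.
have ms : s0 <= Num.max s s0 by rewrite le_max lexx orbT.
have := cu (Num.max s s0); rewrite /= in_itv /= ms => /(_ isT) {}cu.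
apply: (@cvg_comp _ _ _ (fun s => Num.max s s0) u _ _ _ _ cu).
have cm : Num.max t s0 @[t --> s] --> Num.max s s0.
  by apply: (@continuous_max _ _ id (cst s0)); [exact: cvg_id|exact: cvg_cst].
move=> B /= /cm /=; rewrite !nbhs_simpl /=; apply: filterS => t; apply.
by rewrite /= in_itv /= andbT le_max lexx orbT.
Qed.

Lemma continuous_bounded_segment u (a b : R) : a <= b -> continuous u ->
  exists2 M, 0 < M & forall s, a <= s <= b -> `|u s| <= M.
Proof.
move=> ab cu.
have [|c cab cmax] := @EVT_max R (fun s => `|u s|) a b ab.
  by apply: continuous_subspaceT => s; apply: cvg_norm; exact: cu.
exists (`|u c| + 1); first by rewrite ltr_wpDl.
move=> s sab; apply: le_trans (cmax s _) _; first by rewrite in_itv.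
by rewrite lerDl.
Qed.

End one_sided_curves.

Section hilbert_curves.
Variables (R : realType) (H : completeNormedModType R).
Variables (dot : {dot H for idfun}) (hdot : induces_norm dot).

(** The real mean value theorem along the direction [u b - u a]. *)
Lemma hilbert_mean_value (u du : R -> H) (a b M : R) : a <= b ->
  (forall s, a <= s <= b -> is_derive s 1 u (du s)) ->
  (forall s, a <= s <= b -> `|du s| <= M) ->
  `|u b - u a| <= M * (b - a).
Proof.
move=> ab hu hM; have [uab|uab] := eqVneq (u b - u a) 0.
  rewrite uab normr0 mulr_ge0 ?subr_ge0//.
  by apply: le_trans (hM a _) => //; rewrite lexx.
have u0 : 0 < `|u b - u a| by rewrite normr_gt0.
pose phi s := dot (u b - u a) (u s).
have dphi s : a <= s <= b -> is_derive s 1 phi (dot (u b - u a) (du s)).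
  move=> /hu us.
  have := is_derive1_dot hdot (is_derive_cst (u b - u a) s (1 : R)) us.
  by rewrite linear0l add0r.
have [||xi xiab E] := @MVT_segment R phi (fun s => dot (u b - u a) (du s)) a b ab.
- by move=> s; rewrite in_itv /= => /andP[/ltW sa /ltW sb]; apply: dphi; rewrite sa.
- apply: derivable_within_continuous => s; rewrite in_itv /= => /dphi ds.
  exact: ex_derive.
rewrite -(ler_pM2l u0) -expr2 hdot dotBr -/(phi b) -/(phi a) E mulrA.
apply: ler_wpM2r; first by rewrite subr_ge0.
apply: le_trans (dot_le hdot _ _) _; by rewrite ler_wpM2l// hM.
Qed.

Lemma gradient_lipschitz_ball (f : H -> R) :
  (forall B : set H, bounded_set B -> [lipschitz gradient dot f y | y in B]) ->
  forall rho, exists2 L, 0 < L & forall y z, `|y| <= rho -> `|z| <= rho ->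
    `|gradient dot f y - gradient dot f z| <= L * `|y - z|.
Proof.
move=> lip rho; have /lip/pinfty_ex_gt0[L L0 hL] : bounded_set [set y : H | `|y| <= rho].
  by exists rho; split; [exact: num_real|move=> M rM y /= /le_trans; apply; exact: ltW].
by exists L => // y z yr zr; exact: (hL (y, z)).
Qed.

End hilbert_curves.

(** * Reduction to a first-order flow *)

(** The first-order form of the system, with [c = alpha - 1].  The field
    [flow_dv] is the regularised Newton equation
    [y' + lambda^-1 * w' = - (s / c) * w]; since [v = y + lambda^-1 * w] means
    that [y] is the proximal point of [v], it is also the steepest descent
    [v' = - (s / c) * w] for the Moreau envelope of [f].  The field [flow_dx]
    says that [x] relaxes towards [y]. *)
Record newton_flow (R : realType) (H : completeNormedModType R)
    (dot : {dot H for idfun}) (f : H -> R) (s0 lambda c : R)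
    (x y w v : R -> H) : Prop := NewtonFlow {
  flow_w : forall s, w s = gradient dot f (y s) ;
  flow_v : forall s, v s = y s + lambda^-1 *: w s ;
  flow_w_continuous : continuous w ;
  flow_v_continuous : continuous v ;
  flow_dv : forall s, s0 < s -> is_derive s 1 v (- (s / c) *: w s) ;
  flow_dx : forall s, s0 < s -> is_derive s 1 x ((c / s) *: (y s - x s)) }.

Section reduction.
Variables (R : realType) (H : completeNormedModType R).
Variables (dot : {dot H for idfun}) (hdot : induces_norm dot).
Variables (f : H -> R) (s0 lambda alpha : R) (x dx w : R -> H).
Hypothesis gradf_lipschitz : forall B : set H, bounded_set B ->
  [lipschitz gradient dot f y | y in B].
Hypotheses (s0_gt0 : 0 < s0) (lambda_gt0 : 0 < lambda) (alpha_gt1 : 1 < alpha).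
Hypothesis x_sol : strong_solution dot f s0 lambda alpha x dx w.

Let c := alpha - 1.
Let c_gt0 : 0 < c. Proof. by rewrite subr_gt0. Qed.

Let X s := x (Num.max s s0).
Let Y s := X s + (Num.max s s0 / c) *: dx (Num.max s s0).
Let W s := gradient dot f (Y s).
Let V s := Y s + lambda^-1 *: W s.

Let maxE s : s0 <= s -> Num.max s s0 = s.
Proof. by move=> h; apply/max_idPl. Qed.

Let continuous_Y : continuous Y.
Proof.
have cx := continuous_clamp
  (has_derivative_within_continuous (strong_solution_derivative x_sol)).
have cdx := continuous_clamp (strong_solution_continuous x_sol).
move=> s; apply: cvgD; first exact: cx.
apply: cvgZ; last exact: cdx.
apply: cvgM; last exact: cvg_cst.
by apply: (@continuous_max _ _ id (cst s0)); [exact: cvg_id|exact: cvg_cst].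
Qed.

Let continuous_W : continuous W.
Proof.
move=> s; have s11 : s - 1 <= s + 1 by lra.
have [M M0 hM] := continuous_bounded_segment s11 continuous_Y.
have [L L0 hL] := gradient_lipschitz_ball gradf_lipschitz M.
apply/cvgrPdistC_le => e e0.
have /cvgrPdistC_le/(_ (e / L) (divr_gt0 e0 L0)) Ye := @continuous_Y s.
near=> t.
apply: le_trans (hL _ _ _ _) _.
- apply: hM; have : `|s - t| <= 1 by near: t; apply: cvgr_dist_le => //; exact: cvg_id.
  by rewrite ler_norml; lra.
- by apply: hM; lra.
- by rewrite mulrC -ler_pdivlMr//; near: t.
Unshelve. all: by end_near. Qed.

Let continuous_V : continuous V.
Proof.
move=> s; apply: cvgD; first exact: continuous_Y.
by apply: cvgZ; [exact: cvg_cst|exact: continuous_W].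
Qed.

Let is_derive_x s : s0 < s -> is_derive s 1 x (dx s).
Proof.
move=> s0s; apply: (has_derivative_within_ray s0s).
by apply: (strong_solution_derivative x_sol); exact: ltW.
Qed.

Let YE s : s0 <= s -> Y s = x s + (s / c) *: dx s.
Proof. by move=> s0s; rewrite /Y /X maxE. Qed.

Let WE s : s0 <= s -> W s = w s.
Proof. by move=> s0s; rewrite (strong_solution_w x_sol s0s) /W YE. Qed.

Let V_absolutely_continuous a b : s0 < a -> a <= b -> absolutely_continuous_on a b V.
Proof.
move=> s0a ab.
have cdx := continuous_clamp (strong_solution_continuous x_sol).
have [M M0 hM] := continuous_bounded_segment ab cdx.
have [MY MY0 hMY] := continuous_bounded_segment ab continuous_Y.
have [L L0 hL] := gradient_lipschitz_ball gradf_lipschitz MY.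
have b0 : 0 < b by apply: lt_le_trans ab; exact: lt_trans s0a.
have L1 : 0 < 1 + lambda^-1 * L by rewrite ltr_wpDr// mulr_ge0 ?invr_ge0// ltW.
have hdx s : a <= s <= b -> `|dx s| <= M.
  move=> sab; have := hM s sab; rewrite maxE//.
  by rewrite (le_trans (ltW s0a))//; case/andP: sab.
have [c_ge0 b_ge0 M_ge0 L1_ge0] := And4 (ltW c_gt0) (ltW b0) (ltW M0) (ltW L1).
apply: (@absolutely_continuous_dominated _ _ _ dx V a b
  ((1 + lambda^-1 * L) * (b / c)) ((1 + lambda^-1 * L) * (M + M / c))).
- by rewrite mulr_ge0// divr_ge0.
- by rewrite mulr_ge0// addr_ge0// divr_ge0.
- by apply: (strong_solution_ac x_sol) => //; exact: ltW.
move=> p q ap pq qb.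
have s0p : s0 <= p by rewrite (le_trans (ltW s0a)).
have s0q : s0 <= q by rewrite (le_trans s0p).
have pab : a <= p <= b by rewrite ap (le_trans pq qb).
have qab : a <= q <= b by rewrite qb (le_trans ap pq).
have qp0 : 0 <= q - p by rewrite subr_ge0.
(* [V] is controlled by [dx], which is absolutely continuous, up to a
   Lipschitz term: [x] is Lipschitz and the gradient is Lipschitz on a ball
   that contains [Y] on [[a, b]]. *)
have dY : `|Y q - Y p| <= b / c * `|dx q - dx p| + (M + M / c) * (q - p).
  have -> : Y q - Y p = (x q - x p) + (q / c) *: (dx q - dx p) + ((q - p) / c) *: dx p.
    rewrite !YE// opprD addrACA -[RHS]addrA; congr (_ + _).
    by rewrite scalerBr mulrBl scalerBl addrA subrK.
  have xL : `|x q - x p| <= M * (q - p).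
    apply: (hilbert_mean_value hdot pq (du := dx)).
      by move=> s /andP[ps sq]; apply: is_derive_x; rewrite (lt_le_trans s0a)// (le_trans ap).
    by move=> s /andP[ps sq]; apply: hdx; rewrite (le_trans ap ps) (le_trans sq qb).
  apply: le_trans (ler_normD _ _) _.
  apply: le_trans (lerD (ler_normD _ _) (lexx _)) _.
  have s1 : `|(q / c) *: (dx q - dx p)| = q / c * `|dx q - dx p|.
    rewrite normrZ ger0_norm// divr_ge0//.
    by rewrite (le_trans (ltW s0_gt0)).
  have s2 : `|((q - p) / c) *: dx p| = (q - p) / c * `|dx p|.
    by rewrite normrZ ger0_norm// divr_ge0.
  rewrite s1 s2.
  have h2 : q / c * `|dx q - dx p| <= b / c * `|dx q - dx p|.
    by rewrite ler_wpM2r// ler_pM2r ?invr_gt0.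
  have h3 : (q - p) / c * `|dx p| <= (q - p) / c * M.
    by rewrite ler_wpM2l ?hdx// divr_ge0// ltW.
  have -> : (M + M / c) * (q - p) = M * (q - p) + (q - p) / c * M by ring.
  by rewrite [leRHS]addrA; apply: lerD => //; rewrite [leRHS]addrC; exact: lerD.
have dW : `|W q - W p| <= L * `|Y q - Y p| by apply: hL; exact: hMY.
have -> : V q - V p = (Y q - Y p) + lambda^-1 *: (W q - W p).
  by rewrite /V opprD addrACA scalerBr.
apply: le_trans (ler_normD _ _) _.
rewrite normrZ ger0_norm ?invr_ge0 ?(ltW lambda_gt0)// -!mulrA -mulrDr.
apply: (@le_trans _ _ ((1 + lambda^-1 * L) * `|Y q - Y p|)).
  by rewrite mulrDl mul1r lerD2l -mulrA ler_wpM2l// invr_ge0 ltW.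
by rewrite ler_wpM2l ?(ltW L1)// mulrA.
Qed.

Let is_derive_V s : s0 < s -> is_derive s 1 V (- (s / c) *: W s).
Proof.
move=> s0s; apply: (absolutely_continuous_is_derive (g := fun s => - (s / c) *: W s) s0s
  V_absolutely_continuous); last first.
  apply: cvgZ; last exact: continuous_W.
  by apply: cvgN; apply: cvgM; [exact: cvg_id|exact: cvg_cst].
case: (strong_solution_ode x_sol) => N [mN N0 subN].
exists N; split=> // r /= nr; apply: subN => /= ode; apply: nr => s0r.
have [ddx dw odeE] := ode (ltW s0r).
have {}ddx := derivableP ddx; have {}dw := derivableP dw.
set ddxr := 'D_1 dx r in ddx odeE; set dwr := 'D_1 w r in dw odeE.
have r0 : 0 < r by exact: lt_trans s0r.
have dsdx := is_derive1_scale_id ddx.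
have dxr := is_derive_x s0r.
have eqV : \forall t \near r, x t + (c^-1 *: (t *: dx t)) + lambda^-1 *: w t = V t.
  near=> t; have s0t : s0 <= t by near: t; apply: cvgr_ge s0r; exact: cvg_id.
  by rewrite /V YE// WE// scalerA [_^-1 * _]mulrC.
apply: (near_eq_is_derive eqV).
have dd1 := is_deriveD (is_deriveD dxr (is_deriveZ c^-1 dsdx)) (is_deriveZ lambda^-1 dw).
suff <- : dx r + c^-1 *: (dx r + r *: ddxr) + lambda^-1 *: dwr = - (r / c) *: W r.
  exact: dd1.
have -> : W r = - (ddxr + (alpha / r) *: dx r + (c / (lambda * r)) *: dwr).
  by rewrite WE ?ltW//; apply/eqP; rewrite -addr_eq0 addrC odeE.
rewrite scaleNr scalerN opprK !scalerDr !scalerA.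
have -> : r / c * (alpha / r) = 1 + c^-1.
  by rewrite /c; field; rewrite !gt_eqF// -/c.
have -> : r / c * (c / (lambda * r)) = lambda^-1 by field; rewrite !gt_eqF.
by rewrite scalerDl scale1r [r / c]mulrC addrA [_ + (c^-1 * r) *: _]addrC.
Unshelve. all: by end_near. Qed.

(** Multiplied by [s / c], the equation reads [V' = - (s / c) *: W] almost
    everywhere.  [V] is absolutely continuous and the right-hand side is
    continuous, hence [V] is of class C1, although [dx] and [w] may fail to be
    differentiable on a null set.  The curves [Y], [W] and [V] are frozen to the left of
    [s0]. *)
Lemma strong_solution_newton_flow : exists y w' v,
  newton_flow dot f s0 lambda c x y w' v /\
  forall s, s0 <= s -> w' s = w s /\ dx s = (c / s) *: (y s - x s).
Proof.
have dxE s : s0 <= s -> dx s = (c / s) *: (Y s - x s).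
  move=> s0s; have s_gt0 : 0 < s by exact: lt_le_trans s0s.
  rewrite YE// addrAC subrr add0r scalerA.
  have -> : c / s * (s / c) = 1 by field; rewrite !gt_eqF.
  by rewrite scale1r.
exists Y, W, V; split; last by move=> s s0s; split; [exact: WE|exact: dxE].
split => // s s0s; rewrite -dxE ?ltW//; exact: is_derive_x.
Qed.

End reduction.

(** * Asymptotics of real functions *)

Section real_asymptotics.
Variable R : realType.
Implicit Types (phi : R -> R) (a b c : R).

Lemma is_derive_le0_nonincreasing phi (dphi : R -> R) (s0 : R) : continuous phi ->
  (forall s, s0 < s -> is_derive s 1 phi (dphi s)) ->
  (forall s, s0 < s -> dphi s <= 0) ->
  forall p q, s0 <= p -> p <= q -> phi q <= phi p.
Proof.
move=> cphi hd dle p q; apply: ler0_derive1_nincry.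
- by move=> s; rewrite in_itv /= andbT => /hd.
- move=> s; rewrite in_itv /= andbT => s0s.
  by rewrite derive1E (derive_val (is_derive := hd s s0s)) dle.
- exact: continuous_subspaceT.
Qed.

Lemma nonincreasing_ge0_cvg phi (s0 : R) :
  (forall s, s0 <= s -> 0 <= phi s) ->
  (forall p q, s0 <= p -> p <= q -> phi q <= phi p) ->
  exists2 l : R, 0 <= l & phi s @[s --> +oo] --> l.
Proof.
move=> phi0 dec; pose A := [set phi s | s in [set s | s0 <= s]].
have lbA : lbound A 0 by move=> _ [s /= s0s <-]; exact: phi0.
have infA : has_inf A by split; [exists (phi s0); exists s0 => //=|exists 0].
exists (inf A); first by apply: lb_le_inf => //; exact: infA.1.
apply/cvgrPdistC_le => e e0.
have [_ [t /= s0t <-] te] := inf_adherent e0 infA.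
near=> s; have ts : t <= s by near: s; exact: nbhs_pinfty_ge (num_real _).
have Is : inf A <= phi s.
  by apply: ge_inf; [exact: infA.2|exists s => //=; exact: le_trans ts].
rewrite ger0_norm ?subr_ge0//; have := dec _ _ s0t ts; lra.
Unshelve. all: by end_near. Qed.

(** A function whose increments are at most quadratic has nonpositive upper
    derivative everywhere. *)
Lemma quadratic_increment_nonincreasing phi a b (K : R) : a <= b -> 0 <= K ->
  (forall p q, a <= p -> p <= q -> q <= b -> phi q - phi p <= K * (q - p) ^+ 2) ->
  phi b <= phi a.
Proof.
move=> ab K0 hK; apply/ler_addgt0Pl => e e0.
have c0 : 0 < b - a + 1 by rewrite ltr_wpDl// subr_ge0.
have d0 : 0 < e / (b - a + 1) by rewrite divr_gt0.
set d := e / (b - a + 1) in d0.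
have : phi b - phi a <= d * (b - a).
  apply: (interval_induction (P := fun t => phi t - phi a <= d * (t - a)) ab).
    by rewrite !subrr mulr0.
  move=> t _; have K1 : 0 < K + 1 by rewrite ltr_wpDl.
  exists (d / (K + 1)); first by rewrite divr_gt0.
  move=> p q ap pt tq qb; rewrite ltr_pdivlMr// => qpd Pp.
  have pq := le_trans pt tq.
  have := hK p q ap pq qb; have qp0 : 0 <= q - p by rewrite subr_ge0.
  have : K * (q - p) ^+ 2 <= d * (q - p).
    rewrite expr2 mulrA ler_wpM2r//; move: qpd; lra.
  move: Pp; lra.
have : d * (b - a) <= e by rewrite /d mulrAC ler_pdivrMr//; nra.
lra.
Qed.

Lemma powR_le_pinfty c (K : R) : 0 < c -> \forall s \near +oo, K <= s `^ c.
Proof.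
move=> c0; pose K' := Num.max K 0.
have K'0 : 0 <= K' by rewrite le_max lexx orbT.
near=> s; apply: (@le_trans _ _ K'); first by rewrite le_max lexx.
have sK : K' `^ c^-1 <= s by near: s; exact: nbhs_pinfty_ge (num_real _).
have -> : K' = (K' `^ c^-1) `^ c by rewrite -powRrM mulVf ?gt_eqF// powRr1.
by apply: ge0_ler_powR; rewrite ?nnegrE ?powR_ge0 ?(ltW c0)// (le_trans _ sK)// powR_ge0.
Unshelve. all: by end_near. Qed.

(** The integrating factor [s `^ c] turns the inequality
    [s * phi' <= - c * phi + eta] into the monotonicity of
    [s `^ c * (phi - e / 2)] as soon as [eta <= c * (e / 2)], and [s `^ c]
    tends to infinity. *)
Lemma euler_inequality_cvg0 phi (dphi eta : R -> R) (s0 : R) c : 0 < c -> 0 <= s0 ->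
  (forall s, s0 < s -> is_derive s 1 phi (dphi s)) ->
  (forall s, s0 < s -> 0 <= phi s) ->
  (forall s, s0 < s -> s * dphi s <= - c * phi s + eta s) ->
  eta s @[s --> +oo] --> 0 -> phi s @[s --> +oo] --> 0.
Proof.
move=> c0 s00 hd phi0 ineq eta0; apply/cvgrPdistC_le => e e0.
have e20 : 0 < e / 2 by rewrite divr_gt0.
have ce0 : 0 < c * (e / 2) by rewrite mulr_gt0.
have [N [s0N etaN]] : exists N, s0 < N /\ forall s, N <= s -> eta s <= c * (e / 2).
  move/cvgrPdistC_le: eta0 => /(_ _ ce0)[N0 [_ hN0]].
  exists (Num.max (N0 + 1) (s0 + 1)); split.
    by rewrite lt_max (ltrDl s0) ltr01 orbT.
  move=> s; rewrite ge_max => /andP[Ns _]; apply: le_trans (ler_norm _) _.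
  by have := hN0 s; rewrite subr0; apply; apply: lt_le_trans Ns; rewrite ltrDl.
pose psi s := s `^ c * (phi s - e / 2).
have psi_dec s : N <= s -> psi s <= psi N.
  move=> Ns; have dpsi r : s0 < r ->
      is_derive r 1 psi (r `^ (c - 1) * (c * (phi r - e / 2) + r * dphi r)).
    move=> s0r; have r0 : 0 < r by exact: le_lt_trans s0r.
    have dp := is_derive1_powR c r0.
    have dq := is_deriveB (hd r s0r) (is_derive_cst (e / 2) r (1 : R)).
    have dpq := is_deriveM dp dq.
    apply: (@is_derive_eq _ _ _ psi r 1 _ _ dpq).
    rewrite /GRing.scale /= subr0.
    have -> : r `^ c = r `^ (c - 1) * r.
      rewrite -[X in _ * X](powRr1 (ltW r0)) -powRD ?subrK//.
      by rewrite (gt_eqF r0) implybT.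
    rewrite -![(_ - _ : _ -> _) _]/(_ - _) /=; ring.
  apply: (@ler0_derive1_le_cc R psi N s) => //.
  - move=> r; rewrite in_itv /= => /andP[Nr _].
    by have := dpsi r (lt_trans s0N Nr) => -[].
  - move=> r; rewrite in_itv /= => /andP[Nr _]; have s0r := lt_trans s0N Nr.
    rewrite derive1E (derive_val (is_derive := dpsi r s0r)).
    apply: mulr_ge0_le0; first exact: powR_ge0.
    have := ineq r s0r; have := etaN r (ltW Nr); lra.
  - apply: derivable_within_continuous => r; rewrite in_itv /= => /andP[Nr _].
    by have := dpsi r (lt_le_trans s0N Nr) => -[].
  - by rewrite in_itv /= ?lexx ?Ns ?lexx.
  - by rewrite in_itv /= ?lexx ?Ns ?lexx.
near=> s; have Ns : N <= s by near: s; exact: nbhs_pinfty_ge (num_real _).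
have s0s := lt_le_trans s0N Ns.
have s_gt0 := le_lt_trans s00 s0s.
rewrite subr0 ger0_norm ?phi0//.
have K1 : psi N / (e / 2) <= s `^ c by near: s; exact: powR_le_pinfty.
rewrite ler_pdivrMr// in K1.
have := psi_dec s Ns; rewrite {1}/psi => /le_trans/(_ K1).
by rewrite ler_pM2l ?powR_gt0//; lra.
Unshelve. all: by end_near. Qed.

Lemma cvg0_littleo (u : R -> R) (n : nat) :
  s ^+ n * u s @[s --> +oo] --> 0 -> u =o_+oo (fun s => 1 / s ^+ n).
Proof.
move=> hu; apply/eqoP => e e0.
move/cvgrPdistC_le: hu => /(_ e e0) hu.
near=> s; have s0 : 0 < s by near: s; exact: nbhs_pinfty_gt (num_real _).
have sn0 : 0 < s ^+ n by rewrite exprn_gt0.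
have : `|s ^+ n * u s - 0| <= e by near: s.
rewrite subr0 normrM [`|s ^+ n|]gtr0_norm// mul1r normfV [`|s ^+ n|]gtr0_norm//.
by rewrite ler_pdivlMr// mulrC.
Unshelve. all: by end_near. Qed.

End real_asymptotics.

(** * Energy estimates for the flow *)

Section flow.
Variables (R : realType) (H : completeNormedModType R).
Variables (dot : {dot H for idfun}) (hdot : induces_norm dot).
Variables (f : H -> R) (s0 lambda c : R) (x y w v : R -> H).
Hypotheses (f_convex : convex_function setT f) (f_diff : forall z, differentiable f z).
Hypotheses (s0_gt0 : 0 < s0) (lambda_gt0 : 0 < lambda) (c_gt0 : 0 < c).
Hypothesis F : newton_flow dot f s0 lambda c x y w v.

Lemma flow_gradient_le s z : f (y s) + dot (w s) (z - y s) <= f z.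
Proof. by rewrite (flow_w F); exact: convex_gradient_le. Qed.

(** The monotonicity of the gradient of [f] at [y], read at [v]: the map that
    sends [v] to [w] is [lambda^-1]-cocoercive, as the gradient of a Moreau
    envelope. *)
Lemma flow_cocoercive s t :
  lambda^-1 * `|w t - w s| ^+ 2 <= dot (w t - w s) (v t - v s).
Proof.
have h1 := flow_gradient_le s (y t); have h2 := flow_gradient_le t (y s).
rewrite !(flow_v F) hdot; move: h1 h2; rewrite !dotE.
have -> : dot (w s) (w t) = dot (w t) (w s) by exact: dotC.
lra.
Qed.

Lemma flow_w_lipschitz s t : `|w t - w s| <= lambda * `|v t - v s|.
Proof.
have [->|wt] := eqVneq (w t - w s) 0; first by rewrite normr0 mulr_ge0// ltW.
have w0 : 0 < `|w t - w s| by rewrite normr_gt0.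
rewrite -ler_pdivrMl// -(ler_pM2l w0) mulrCA -expr2.
exact: le_trans (flow_cocoercive s t) (dot_le hdot _ _).
Qed.

(** The value at [v s] of the Moreau envelope of [f] of index [lambda^-1],
    with the minimisation already carried out at the proximal point [y s]. *)
Definition envelope s := f (y s) + (2 * lambda)^-1 * `|w s| ^+ 2.

(** The envelope is convex with gradient [w]; here only along the curve. *)
Lemma envelope_ge s t : envelope s + dot (w s) (v t - v s) <= envelope t.
Proof.
have h := flow_gradient_le s (y t).
have : 0 <= (2 * lambda)^-1 * `|w t - w s| ^+ 2.
  by rewrite mulr_ge0// invr_ge0 mulr_ge0// ltW.
rewrite /envelope !(flow_v F) (sqr_normB hdot) invfM; move: h; rewrite !dotE.
have -> : dot (w s) (w s) = `|w s| ^+ 2 by rewrite hdot.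
have -> : dot (w s) (w t) = dot (w t) (w s) by exact: dotC.
lra.
Qed.

(** [w] is only continuous, so the chain rule through [y] and [w] is not
    available.  Instead the convexity inequality, used in both directions,
    bounds the error of the first-order expansion by
    [`|w t - w s| * `|v t - v s|]. *)
Lemma is_derive_envelope s : s0 < s ->
  is_derive s 1 envelope (- (s / c) * `|w s| ^+ 2).
Proof.
move=> s0s; have dv := flow_dv F s0s.
pose g t := dot (w s) (v t).
have dg : is_derive s 1 g (- (s / c) * `|w s| ^+ 2).
  have := is_derive1_dot hdot (is_derive_cst (w s) s (1 : R)) dv.
  by rewrite linear0l add0r dotZr hdot.
pose h t := envelope t - g t.
have hle t : `|h t - h s| <= `|w t - w s| * `|v t - v s|.
  have h1 := envelope_ge s t; have h2 := envelope_ge t s.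
  have h3 := dot_le hdot (w t - w s) (v t - v s).
  rewrite ger0_norm; rewrite /h /g; move: h1 h2 h3; rewrite !dotE; lra.
have dh : is_derive s 1 h 0.
  apply/is_derive1_estimateP => e e0; set V' := - (s / c) *: w s in dv.
  have k0 : 0 < `|V'| + 1 by rewrite ltr_wpDl.
  have [d d0 hd] := (is_derive1_estimateP _ _ _).1 dv 1 ltr01.
  have cw := @flow_w_continuous _ _ _ _ _ _ _ _ _ _ _ F s.
  have /cvgrPdistC_le/(_ (e / (`|V'| + 1)) (divr_gt0 e0 k0)) := cw.
  move=> /nbhs_ballP[d' /= d'0 hd'].
  exists (Num.min d d'); first by rewrite lt_min d0 d'0.
  move=> t; rewrite lt_min => /andP[td td']; rewrite scaler0 subr0.
  apply: le_trans (hle t) _.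
  have wt : `|w t - w s| <= e / (`|V'| + 1).
    by apply: (hd' t); rewrite -ball_normE /= distrC.
  have vt : `|v t - v s| <= (`|V'| + 1) * `|t - s|.
    rewrite -(subrK ((t - s) *: V') (v t - v s)).
    apply: le_trans (ler_normD _ _) _; rewrite normrZ mulrDl mul1r addrC [X in X + _]mulrC.
    by rewrite lerD2l; have := hd t td; rewrite mul1r.
  apply: le_trans (ler_pM _ _ wt vt) _ => //.
  by rewrite mulrA divfK ?gt_eqF.
have -> : envelope = (fun t => h t + g t).
  by apply/funext => t; rewrite /h subrK.
by rewrite -[X in is_derive _ _ _ X]add0r; exact: is_deriveD.
Qed.

Lemma continuous_y : continuous y.
Proof.
move=> s; have -> : y = (fun t => v t - lambda^-1 *: w t).
  by apply/funext => t; rewrite (flow_v F) addrK.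
apply: cvgB; first exact: (flow_v_continuous F).
by apply: cvgZ; [exact: cvg_cst|exact: (flow_w_continuous F)].
Qed.

Lemma continuous_envelope : continuous envelope.
Proof.
move=> s; apply: cvgD.
  apply: (@cvg_comp _ _ _ y f _ (nbhs (y s))); first exact: continuous_y.
  exact: differentiable_continuous.
apply: cvgM; first exact: cvg_cst.
by apply: cvg_sqr_norm; exact: (flow_w_continuous F).
Qed.

Section minimiser.
Variables (z : H) (z_min : argmin f z).

Let fz u : f z <= f u. Proof. exact: z_min. Qed.

Lemma flow_dist_ge s : envelope s - f z <= dot (w s) (v s - z).
Proof.
have h := flow_gradient_le s z.
have : 0 <= (2 * lambda)^-1 * `|w s| ^+ 2.
  by rewrite mulr_ge0// invr_ge0 mulr_ge0// ltW.
rewrite /envelope (flow_v F) invfM; move: h; rewrite !dotE.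
have -> : dot (w s) (w s) = `|w s| ^+ 2 by rewrite hdot.
lra.
Qed.

Lemma envelope_ge_min s : 0 <= envelope s - f z.
Proof.
rewrite subr_ge0 /envelope (le_trans (fz (y s)))// lerDl.
by rewrite mulr_ge0// invr_ge0 mulr_ge0// ltW.
Qed.

Lemma is_derive_flow_dist s : s0 < s ->
  is_derive s 1 (fun t => `|v t - z| ^+ 2) (- (2 * (s / c)) * dot (w s) (v s - z)).
Proof.
move=> /(flow_dv F) dv.
have dvz : is_derive s 1 (fun t => v t - z) (- (s / c) *: w s).
  by have := is_deriveB dv (is_derive_cst z s (1 : R)); rewrite subr0.
have := is_derive1_sqr_norm hdot dvz.
by rewrite dotZr (dotC dot (v s - z)); congr (is_derive _ _ _ _); ring.
Qed.

Lemma continuous_flow_dist : continuous (fun t => `|v t - z| ^+ 2).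
Proof.
move=> s; apply: cvg_sqr_norm.
by apply: cvgB; [exact: (flow_v_continuous F)|exact: cvg_cst].
Qed.

Lemma flow_dist_nonincreasing p q : s0 <= p -> p <= q -> `|v q - z| <= `|v p - z|.
Proof.
move=> s0p pq; rewrite -(@ler_pXn2r _ 2)// ?nnegrE//.
apply: (is_derive_le0_nonincreasing continuous_flow_dist is_derive_flow_dist _ s0p pq).
move=> s s0s; rewrite mulNr oppr_le0 !mulr_ge0 ?invr_ge0 ?(ltW c_gt0)//.
  by rewrite ltW// (lt_trans s0_gt0).
exact: le_trans (envelope_ge_min s) (flow_dist_ge s).
Qed.

Lemma flow_dist_cvg : exists2 l : R, 0 <= l & `|v s - z| ^+ 2 @[s --> +oo] --> l.
Proof.
apply: (@nonincreasing_ge0_cvg _ _ s0); first by move=> s _; exact: sqr_ge0.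
by move=> p q s0p pq; rewrite ler_pXn2r ?nnegrE// flow_dist_nonincreasing.
Qed.

Lemma flow_w_le s : `|w s| <= lambda * `|v s - z|.
Proof.
have h := flow_gradient_le s z; have h' := fz (y s).
have [->|ws] := eqVneq (w s) 0; first by rewrite normr0 mulr_ge0// ltW.
have w0 : 0 < `|w s| by rewrite normr_gt0.
rewrite -ler_pdivrMl// -(ler_pM2l w0) mulrCA -expr2.
apply: le_trans (dot_le hdot (w s) (v s - z)).
rewrite (flow_v F) hdot; move: h; rewrite !dotE; lra.
Qed.

Lemma flow_w_bounded s : s0 <= s -> `|w s| <= lambda * `|v s0 - z|.
Proof.
move=> s0s; apply: le_trans (flow_w_le s) _.
by rewrite ler_wpM2l// ?(ltW lambda_gt0)// flow_dist_nonincreasing.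
Qed.

(** Formally [(`|w| ^+ 2)' = 2 * dot w w'] is nonpositive by monotonicity,
    since [w] is a negative multiple of [v'].  Without [w'], the mean value
    theorem for [dot (w b - w a) v] shows that [dot (w b - w a) (w xi) <= 0]
    at some intermediate [xi], and the Lipschitz continuity of [w] makes the
    rest of the increment of [`|w| ^+ 2] quadratic in [b - a]. *)
Lemma flow_norm_w_nonincreasing p q : s0 < p -> p <= q -> `|w q| <= `|w p|.
Proof.
move=> s0p pq; rewrite -(@ler_pXn2r _ 2)// ?nnegrE//.
have q0 : 0 < q by rewrite (lt_trans s0_gt0)// (lt_le_trans s0p).
pose B := lambda * `|v s0 - z|.
have B0 : 0 <= B by rewrite mulr_ge0// ltW.
pose K := lambda * (q / c * B).
have K0 : 0 <= K by rewrite !mulr_ge0 ?invr_ge0// ltW.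
have wK a b : p <= a -> a <= b -> b <= q -> `|w b - w a| <= K * (b - a).
  move=> pa ab bq; apply: le_trans (flow_w_lipschitz _ _) _.
  rewrite -mulrA ler_wpM2l ?(ltW lambda_gt0)//.
  apply: (hilbert_mean_value hdot ab (du := fun s => - (s / c) *: w s)).
    by move=> s /andP[as_ _]; apply: (flow_dv F); rewrite (lt_le_trans s0p)// (le_trans pa).
  move=> s /andP[as_ sb]; have ps := le_trans pa as_.
  have s_gt0 : 0 < s by rewrite (lt_le_trans _ ps)// (lt_trans s0_gt0).
  rewrite normrZ normrN ger0_norm ?divr_ge0 ?(ltW s_gt0) ?(ltW c_gt0)//.
  apply: ler_pM => //; first by rewrite divr_ge0// ltW.
    by rewrite ler_pM2r ?invr_gt0// (le_trans sb).
  by apply: flow_w_bounded; rewrite (le_trans (ltW s0p)).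
apply: (@quadratic_increment_nonincreasing R (fun s => `|w s| ^+ 2) p q (2 * K ^+ 2)) => //.
  by rewrite mulr_ge0// sqr_ge0.
move=> a b pa ab bq; have [->|ab'] := eqVneq a b; first by rewrite !subrr expr0n mulr0.
have {}ab' : a < b by rewrite lt_neqAle ab'.
pose d := w b - w a.
pose phi s := dot d (v s).
have s0s s : a <= s -> s0 < s by move=> as_; rewrite (lt_le_trans s0p)// (le_trans pa).
have dphi s : a <= s -> is_derive s 1 phi (- (s / c) * dot d (w s)).
  move=> /s0s/(flow_dv F) dv.
  have := is_derive1_dot hdot (is_derive_cst d s (1 : R)) dv.
  by rewrite linear0l add0r dotZr.
have [||xi xiab E] := @MVT R phi (fun s => - (s / c) * dot d (w s)) a b ab'.
- by move=> s; rewrite in_itv /= => /andP[/ltW as_ _]; exact: dphi.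
- apply: derivable_within_continuous => s; rewrite in_itv /= => /andP[as_ _].
  by have [] := dphi s as_.
move: xiab; rewrite in_itv /= => /andP[axi xib].
have dxi : dot d (w xi) <= 0.
  have : 0 <= phi b - phi a.
    rewrite /phi -dotBr; apply: le_trans (flow_cocoercive a b).
    by rewrite mulr_ge0// invr_ge0 ltW.
  rewrite E mulNr mulNr oppr_ge0 pmulr_lle0 ?subr_gt0//.
  by rewrite pmulr_rle0// divr_gt0// (lt_trans s0_gt0)// s0s// ltW.
have -> : `|w b| ^+ 2 - `|w a| ^+ 2 =
    2 * dot d (w xi) + dot d ((w b - w xi) - (w xi - w a)).
  by rewrite !hdot /d !dotE (dotC dot (w a) (w b)); ring.
have n1 : `|d| <= K * (b - a) by apply: wK.
have n2 : `|(w b - w xi) - (w xi - w a)| <= 2 * (K * (b - a)).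
  apply: le_trans (ler_normB _ _) _.
  have h1 : `|w b - w xi| <= K * (b - xi).
    by apply: wK => //; [exact: le_trans (ltW axi)|exact: ltW].
  have h2 : `|w xi - w a| <= K * (xi - a).
    by apply: wK => //; [exact: ltW|exact: le_trans (ltW xib) bq].
  have : 0 <= K * (b - xi) by rewrite mulr_ge0// subr_ge0 ltW.
  have : 0 <= K * (xi - a) by rewrite mulr_ge0// subr_ge0 ltW.
  by move: h1 h2; lra.
have n3 := dot_le hdot d ((w b - w xi) - (w xi - w a)).
have n4 := ler_pM (normr_ge0 _) (normr_ge0 _) n1 n2.
have -> : 2 * K ^+ 2 * (b - a) ^+ 2 = K * (b - a) * (2 * (K * (b - a))) by ring.
by apply: le_trans (le_trans n3 n4); rewrite gerDr pmulr_rle0.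
Qed.

(** The weight [c] on the squared distance is chosen so that its decay
    [- 2 * s * dot w (v - z)] absorbs the derivative [2 * s] of [s ^+ 2],
    by [flow_dist_ge]. *)
Definition lyapunov s := s ^+ 2 * (envelope s - f z) + c * `|v s - z| ^+ 2.

Definition dissipation s :=
  s ^+ 3 / c * `|w s| ^+ 2 + 2 * s * (dot (w s) (v s - z) - (envelope s - f z)).

Lemma is_derive_lyapunov s : s0 < s -> is_derive s 1 lyapunov (- dissipation s).
Proof.
move=> s0s; have de := is_deriveB (is_derive_envelope s0s) (is_derive_cst (f z) s (1 : R)).
have ds : is_derive s 1 (fun t : R => t ^+ 2) (2 * s).
  have := is_deriveX 2 (is_derive_id s (1 : R)).
  by rewrite /GRing.scale /= mulr1 expr1.
have dd := is_deriveZ c (is_derive_flow_dist s0s).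
have dl := is_deriveD (is_deriveM ds de) dd.
apply: (@is_derive_eq _ _ _ lyapunov s 1 _ _ dl).
rewrite /dissipation /GRing.scale /= subr0 /cst -![(_ - _ : _ -> _) _]/(_ - _) /=.
by field; rewrite gt_eqF.
Qed.

Lemma dissipation_ge s : 0 <= s -> s ^+ 3 / c * `|w s| ^+ 2 <= dissipation s.
Proof.
move=> s_ge0; rewrite /dissipation lerDl mulr_ge0 ?mulr_ge0// subr_ge0.
exact: flow_dist_ge.
Qed.

Lemma dissipation_ge0 s : 0 <= s -> 0 <= dissipation s.
Proof.
move=> s_ge0; apply: le_trans (dissipation_ge s_ge0).
by rewrite mulr_ge0 ?sqr_ge0// mulr_ge0 ?exprn_ge0// invr_ge0 ltW.
Qed.

Lemma continuous_lyapunov : continuous lyapunov.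
Proof.
move=> s; apply: cvgD.
  apply: cvgM; first by apply: exprn_continuous.
  by apply: cvgB; [exact: continuous_envelope|exact: cvg_cst].
by apply: cvgM; [exact: cvg_cst|exact: continuous_flow_dist].
Qed.

Lemma continuous_dissipation : continuous dissipation.
Proof.
move=> s; have cw := @flow_w_continuous _ _ _ _ _ _ _ _ _ _ _ F s.
have cv := @flow_v_continuous _ _ _ _ _ _ _ _ _ _ _ F s.
apply: cvgD.
  apply: cvgM; last exact: cvg_sqr_norm.
  by apply: cvgM; [exact: exprn_continuous|exact: cvg_cst].
apply: cvgM; first by apply: cvgM; [exact: cvg_cst|exact: cvg_id].
apply: cvgB; first by apply: cvg_dot => //; apply: cvgB => //; exact: cvg_cst.
by apply: cvgB; [exact: continuous_envelope|exact: cvg_cst].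
Qed.

Lemma lyapunov_cvg : exists2 l : R, 0 <= l & lyapunov s @[s --> +oo] --> l.
Proof.
apply: (@nonincreasing_ge0_cvg _ _ s0).
  move=> s s0s; rewrite /lyapunov addr_ge0//.
    by rewrite mulr_ge0 ?sqr_ge0 ?envelope_ge_min.
  by rewrite mulr_ge0 ?sqr_ge0 ?(ltW c_gt0).
apply: (is_derive_le0_nonincreasing continuous_lyapunov is_derive_lyapunov).
by move=> s s0s; rewrite oppr_le0 dissipation_ge0// ltW// (lt_trans s0_gt0).
Qed.

(** [c * dissipation] dominates the integrand and is the exact derivative of
    [- c * lyapunov], which converges at infinity. *)
Lemma flow_integral_lty :
  (\int[@lebesgue_measure R]_(s in `[s0, +oo[) (s ^+ 3 * `|w s| ^+ 2)%:E < +oo)%E.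
Proof.
have [l _ cl] := lyapunov_cvg.
have s_ge0 s : s0 <= s -> 0 <= s by move=> s0s; exact: le_trans (ltW s0_gt0) s0s.
have ccont : continuous (fun s => c * dissipation s).
  by move=> s; apply: cvgM; [exact: cvg_cst|exact: continuous_dissipation].
have I : (\int[@lebesgue_measure R]_(s in `[s0, +oo[) (c * dissipation s)%:E =
    (- c * l)%:E - (- c * lyapunov s0)%:E)%E.
  apply: (@ge0_continuous_FTC2y R (fun s => c * dissipation s) (fun s => - c * lyapunov s)).
  - by move=> s s0s; rewrite mulr_ge0 ?(ltW c_gt0) ?dissipation_ge0 ?s_ge0.
  - exact: continuous_subspaceT.
  - by apply: cvgM; [exact: cvg_cst|].
  - by move=> s s0s; have [] := is_deriveZ (- c) (is_derive_lyapunov s0s).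
  - apply: cvg_within_filter; apply: cvgM; first exact: cvg_cst.
    exact: continuous_lyapunov.
  - move=> s; rewrite in_itv /= andbT => s0s; rewrite derive1E.
    rewrite (derive_val (is_derive := is_deriveZ (- c) (is_derive_lyapunov s0s))).
    by rewrite /GRing.scale /= mulrNN.
apply: (@le_lt_trans _ _
  (\int[@lebesgue_measure R]_(s in `[s0, +oo[) (c * dissipation s)%:E)%E).
  apply: ge0_le_integral => //.
  - move=> s /=; rewrite in_itv /= andbT lee_fin => /s_ge0 s00.
    by rewrite mulr_ge0 ?sqr_ge0 ?exprn_ge0.
  - apply/measurable_EFinP; apply: measurable_funTS.
    apply: continuous_measurable_fun => s; apply: cvgM; first exact: exprn_continuous.
    by apply: cvg_sqr_norm; exact: (flow_w_continuous F).
  - apply/measurable_EFinP; apply: measurable_funTS.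
    exact: continuous_measurable_fun.
  - move=> s /=; rewrite in_itv /= andbT lee_fin => /s_ge0 s00.
    have := ler_wpM2l (ltW c_gt0) (dissipation_ge s00).
    suff -> : c * (s ^+ 3 / c * `|w s| ^+ 2) = s ^+ 3 * `|w s| ^+ 2 by [].
    by field; rewrite gt_eqF.
by rewrite I -EFinB ltry.
Qed.

(** The decrease of the convergent function [lyapunov] between [s / 2] and [s]
    tends to 0, and it is at least a multiple of [s ^+ 4 * `|w s| ^+ 2] since
    [`|w|] is nonincreasing. *)
Lemma flow_norm_w_rate : s ^+ 2 * `|w s| @[s --> +oo] --> 0.
Proof.
have [l _ cl] := lyapunov_cvg.
apply/cvgrPdistC_le => e e0.
have e1 : 0 < e ^+ 2 / (32 * c) by rewrite divr_gt0 ?exprn_gt0 ?mulr_gt0.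
move/cvgrPdistC_le: cl => /(_ _ e1) [N [_ hN]].
near=> s.
have s2N : N < s / 2.
  by rewrite ltr_pdivlMr//; near: s; exact: nbhs_pinfty_gt (num_real _).
have s2s0 : s0 < s / 2.
  by rewrite ltr_pdivlMr//; near: s; exact: nbhs_pinfty_gt (num_real _).
set r := s / 2 in s2N s2s0 *; have sE : s = 2 * r by rewrite /r; field.
have r0 : 0 < r by exact: lt_trans s2s0.
have rs : r < s by rewrite sE ltr_pMl// ltr1n.
rewrite subr0 ger0_norm ?mulr_ge0 ?sqr_ge0//.
have [||xi xirs E] := @MVT R lyapunov (fun s => - dissipation s) r s rs.
- move=> t; rewrite in_itv /= => /andP[rt _].
  by apply: is_derive_lyapunov; exact: lt_trans rt.
- exact: continuous_subspaceT continuous_lyapunov.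
move: xirs; rewrite in_itv /= => /andP[rxi xis].
have xi0 : 0 < xi by exact: lt_trans rxi.
have h1 := hN r s2N; have h2 := hN s (lt_trans s2N rs).
have h3 : lyapunov r - lyapunov s <= e ^+ 2 / (32 * c) + e ^+ 2 / (32 * c).
  by move: h1 h2; rewrite /= !ler_norml; lra.
have h4 : lyapunov r - lyapunov s = dissipation xi * r.
  by rewrite -opprB E mulNr opprK sE; congr (_ * _); ring.
have h5 : r ^+ 3 / c * `|w s| ^+ 2 <= dissipation xi.
  apply: le_trans (dissipation_ge (ltW xi0)); apply: ler_pM => //.
  - by rewrite divr_ge0 ?exprn_ge0// ltW.
  - by rewrite ler_pM2r ?invr_gt0// ler_pXn2r ?nnegrE// ltW.
  - rewrite ler_pXn2r ?nnegrE// flow_norm_w_nonincreasing//; last exact: ltW.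
    exact: lt_trans rxi.
rewrite -(@ler_pXn2r _ 2)// ?nnegrE ?mulr_ge0 ?sqr_ge0 ?(ltW e0)//.
have := ler_wpM2r (ltW r0) h5; rewrite -h4 => /le_trans/(_ h3) h6.
have -> : (s ^+ 2 * `|w s|) ^+ 2 = 16 * c * (r ^+ 3 / c * `|w s| ^+ 2 * r).
  by rewrite {1}sE; field; rewrite gt_eqF.
have -> : e ^+ 2 = 16 * c * (e ^+ 2 / (32 * c) + e ^+ 2 / (32 * c)).
  by field; rewrite gt_eqF.
by rewrite ler_pM2l// mulr_gt0.
Unshelve. all: by end_near. Qed.

Lemma norm_w_cvg0 : `|w s| @[s --> +oo] --> 0.
Proof.
apply/cvgrPdistC_le => e e0; move/cvgrPdistC_le: flow_norm_w_rate => /(_ e e0) h.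
near=> s; have s1 : 1 <= s by near: s; exact: nbhs_pinfty_ge (num_real _).
have : `|s ^+ 2 * `|w s| - 0| <= e by near: s.
rewrite !subr0 normr_id normrM normr_id; apply: le_trans.
by rewrite ler_peMl// ger0_norm ?sqr_ge0// exprn_ege1.
Unshelve. all: by end_near. Qed.

(** [u = x - v] satisfies [s * u' = - c * u + eta] with [eta] tending to 0,
    hence [`|u| ^+ 2] satisfies an Euler inequality. *)
Lemma flow_x_v_cvg0 : `|x s - v s| @[s --> +oo] --> 0.
Proof.
pose eta s := (s ^+ 2 / c - c / lambda) *: w s.
have eta0 : `|eta s| @[s --> +oo] --> 0.
  have h : c^-1 * (s ^+ 2 * `|w s|) + (c / lambda) * `|w s| @[s --> +oo] --> 0.
    rewrite -[X in _ --> X](_ : c^-1 * 0 + (c / lambda) * 0 = 0); last first.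
      by rewrite !mulr0 addr0.
    apply: cvgD; apply: cvgM; [exact: cvg_cst|exact: flow_norm_w_rate|
      exact: cvg_cst|exact: norm_w_cvg0].
  apply: (@squeeze_cvgr _ _ _ _ (fun=> 0)
    (fun s => c^-1 * (s ^+ 2 * `|w s|) + (c / lambda) * `|w s|)) => //; last first.
    exact: cvg_cst.
  near=> s; rewrite normr_ge0 /= normrZ mulrA -mulrDl ler_wpM2r//.
  apply: le_trans (ler_normB _ _) _.
  rewrite ger0_norm ?divr_ge0 ?sqr_ge0 ?(ltW c_gt0)//.
  by rewrite ger0_norm ?divr_ge0 ?(ltW lambda_gt0) ?(ltW c_gt0)// mulrC.
have hsq : `|x s - v s| ^+ 2 @[s --> +oo] --> 0.
  apply: (@euler_inequality_cvg0 _ _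
    (fun s => 2 * dot (x s - v s) ((c / s) *: (y s - x s) - - (s / c) *: w s))
    (fun s => c^-1 * `|eta s| ^+ 2) s0 c) => //; first exact: ltW.
  - move=> s s0s; apply: (is_derive1_sqr_norm hdot).
    exact: is_deriveB (flow_dx F s0s) (flow_dv F s0s).
  - move=> s s0s; have s_gt0 : 0 < s by exact: lt_trans s0s.
    have uE : s *: ((c / s) *: (y s - x s) - - (s / c) *: w s) =
        - c *: (x s - v s) + eta s.
      have -> : y s = v s - lambda^-1 *: w s by rewrite (flow_v F) addrK.
      have -> : v s - lambda^-1 *: w s - x s = - (x s - v s) - lambda^-1 *: w s.
        by rewrite opprB addrAC.
      rewrite scaleNr opprK scalerDr !scalerA /eta [s * (c / s)]mulrC divfK ?gt_eqF//.
      rewrite scalerBr scalerN -scaleNr -addrA scalerA; congr (_ + _).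
      by rewrite addrC -scalerBl mulrA expr2.
    rewrite mulrCA -dotZr uE dotDr dotZr -hdot.
    have h1 := dot_le hdot (x s - v s) (eta s).
    (* Young's inequality, to absorb half of [2 * c * `|x s - v s| ^+ 2]. *)
    have h2 : 2 * (`|x s - v s| * `|eta s|) <=
        c * `|x s - v s| ^+ 2 + c^-1 * `|eta s| ^+ 2.
      rewrite -subr_ge0; set lhs := (X in 0 <= X).
      have -> : lhs = c^-1 * (c * `|x s - v s| - `|eta s|) ^+ 2.
        by rewrite /lhs; field; rewrite gt_eqF.
      by rewrite mulr_ge0 ?sqr_ge0// invr_ge0 ltW.
    lra.
  - rewrite -[X in _ --> X](_ : c^-1 * (0 * 0) = 0); last by rewrite !mulr0.
    by apply: cvgM; [exact: cvg_cst|exact: cvgM].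
apply/cvgrPdistC_le => e e0; move/cvgrPdistC_le: hsq => /(_ (e ^+ 2) (exprn_gt0 _ e0)) h.
near=> s; have : `| `|x s - v s| ^+ 2 - 0| <= e ^+ 2 by near: s.
rewrite !subr0 normr_id ger0_norm ?sqr_ge0// ler_pXn2r ?nnegrE//; exact: ltW.
Unshelve. all: by end_near. Qed.

Lemma flow_velocity_rate : s * `|(c / s) *: (y s - x s)| @[s --> +oo] --> 0.
Proof.
have h : c * (`|x s - v s| + lambda^-1 * `|w s|) @[s --> +oo] --> 0.
  rewrite -[X in _ --> X](_ : c * (0 + lambda^-1 * 0) = 0); last by rewrite !(mulr0, addr0).
  apply: cvgM; first exact: cvg_cst.
  apply: cvgD; first exact: flow_x_v_cvg0.
  by apply: cvgM; [exact: cvg_cst|exact: norm_w_cvg0].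
apply: (@squeeze_cvgr _ _ _ _ (fun=> 0)
  (fun s => c * (`|x s - v s| + lambda^-1 * `|w s|))) => //; last exact: cvg_cst.
near=> s; have s_gt0 : 0 < s by near: s; exact: nbhs_pinfty_gt (num_real _).
rewrite mulr_ge0 ?(ltW s_gt0)//= normrZ ger0_norm ?divr_ge0 ?(ltW s_gt0) ?(ltW c_gt0)//.
rewrite mulrA [s * _]mulrC divfK ?gt_eqF// ler_pM2l//.
have -> : y s - x s = - (x s - v s) - lambda^-1 *: w s.
  by rewrite (flow_v F) !opprB addrAC addrK.
apply: le_trans (ler_normB _ _) _; rewrite normrN lerD2l normrZ.
by rewrite ger0_norm// invr_ge0 ltW.
Unshelve. all: by end_near. Qed.

(** By convexity [s * (f x)' <= c * (f y - f x)].  The weight [s ^+ 2] costs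
    [2], which leaves the positive rate [c - 2], and [s ^+ 2 * (f y - f z)] is
    at most a multiple of [s ^+ 2 * `|w|]. *)
Lemma flow_value_rate : 2 < c -> s ^+ 2 * (f (x s) - f z) @[s --> +oo] --> 0.
Proof.
move=> c2.
pose B := 2 * `|v s0 - z|.
have yB s : s0 <= s -> `|y s - z| <= B.
  move=> s0s; have -> : y s - z = (v s - z) - lambda^-1 *: w s.
    by rewrite (flow_v F) addrAC addrK.
  apply: le_trans (ler_normB _ _) _; rewrite /B mulr_natl mulr2n.
  apply: lerD; first exact: flow_dist_nonincreasing.
  rewrite normrZ ger0_norm ?invr_ge0 ?(ltW lambda_gt0)// ler_pdivrMl//.
  exact: flow_w_bounded.
apply: (@euler_inequality_cvg0 _ _
  (fun s => s ^+ 2 * dot (gradient dot f (x s)) ((c / s) *: (y s - x s)) +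
            (f (x s) - f z) * (2 * s))
  (fun s => c * (B * (s ^+ 2 * `|w s|))) s0 (c - 2)).
- by rewrite subr_gt0.
- exact: ltW.
- move=> s s0s.
  have ds : is_derive s 1 (fun t : R => t ^+ 2) (2 * s).
    have := is_deriveX 2 (is_derive_id s (1 : R)).
    by rewrite /GRing.scale /= mulr1 expr1.
  have dfx := is_derive1_comp_gradient hdot (f_diff (x s)) (flow_dx F s0s).
  have dd := is_deriveM ds (is_deriveB dfx (is_derive_cst (f z) s (1 : R))).
  by rewrite subr0 in dd; exact: dd.
- by move=> s _; rewrite mulr_ge0 ?sqr_ge0// subr_ge0.
- move=> s s0s; have s_gt0 : 0 < s by exact: lt_trans s0s.
  have h1 := convex_gradient_le hdot (y s) f_convex (f_diff (x s)).
  have h2 := flow_gradient_le s z.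
  have h3 : dot (w s) (y s - z) <= B * `|w s|.
    by apply: le_trans (dot_le hdot _ _) _; rewrite mulrC ler_wpM2r// yB// ltW.
  set G := dot (gradient dot f (x s)) (y s - x s) in h1.
  have h4 : s ^+ 2 * G <= s ^+ 2 * (f (y s) - f (x s)).
    by rewrite ler_wpM2l ?sqr_ge0//; lra.
  have h5 : s ^+ 2 * (f (y s) - f z) <= s ^+ 2 * (B * `|w s|).
    rewrite ler_wpM2l ?sqr_ge0//; apply: le_trans h3; move: h2.
    by rewrite !dotBr; lra.
  rewrite dotZr -/G.
  have -> : s * (s ^+ 2 * (c / s * G) + (f (x s) - f z) * (2 * s)) =
    c * (s ^+ 2 * G) + 2 * (s ^+ 2 * (f (x s) - f z)) by field; rewrite gt_eqF.
  have := ler_wpM2l (ltW c_gt0) h4; have := ler_wpM2l (ltW c_gt0) h5.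
  lra.
- rewrite -[X in _ --> X](_ : c * (B * 0) = 0); last by rewrite !mulr0.
  apply: cvgM; first exact: cvg_cst.
  by apply: cvgM; [exact: cvg_cst|exact: flow_norm_w_rate].
Qed.

End minimiser.
End flow.

(** * Weak convergence by asymptotic centres *)

Section weak_convergence.
Variables (R : realType) (H : completeNormedModType R).
Variables (dot : {dot H for idfun}) (hdot : induces_norm dot).
Variable T : Type.
Implicit Types (F G : set_system T) (v : T -> H).

(** [l] minimises the upper limit along [F] of the squared distance to [v],
    and [rho] is the minimum; upper limits are expressed by eventual
    bounds. *)
Definition asymptotic_center F v (l : H) (rho : R) :=
  (forall u r, (\forall t \near F, `|v t - u| ^+ 2 <= r) -> rho <= r) /\
  (forall e, 0 < e -> \forall t \near F, `|v t - l| ^+ 2 <= rho + e).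

Lemma asymptotic_center_exists F v (M : R) : ProperFilter F ->
  (\forall t \near F, `|v t| <= M) -> exists l rho, asymptotic_center F v l rho.
Proof.
move=> FF vM; pose E u r := \forall t \near F, `|v t - u| ^+ 2 <= r.
have [||||l [rho [rhoE lE]]] := @midpoint_convex_minimizer R H E 4^-1 0.
- by [].
- exists 0, (M ^+ 2); apply: filterS vM => t vt.
  by rewrite subr0 ler_pXn2r ?nnegrE// (le_trans _ vt).
- by move=> u r /filter_ex[t]; apply: le_trans; exact: sqr_ge0.
- move=> u u' r r' Eu Eu'; apply: filterS2 Eu Eu' => t vu vu'.
  have -> : v t - 2^-1 *: (u + u') = 2^-1 *: ((v t - u) + (v t - u')).
    have vv : 2^-1 *: (v t + v t) = v t.
      have -> : v t + v t = 2 *: v t by rewrite scaler_nat mulr2n.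
      by rewrite scalerA mulVf ?scale1r.
    by rewrite addrACA -opprD scalerBr vv.
  rewrite (sqr_norm_midpoint hdot).
  have -> : v t - u - (v t - u') = - (u - u') by rewrite !opprB addrC subrKA.
  by rewrite normrN; move: vu vu'; lra.
exists l, rho; split=> // e e0.
have M0 : 0 <= M by have [t vt] := filter_ex vM; exact: le_trans vt.
pose K := M + `|l| + 1.
have K0 : 0 <= K by rewrite !addr_ge0.
have K2 : 0 < 2 + 2 * K by rewrite ltr_wpDr// mulr_ge0.
pose d := Num.min 1 (e / (2 + 2 * K)).
have d0 : 0 < d by rewrite lt_min ltr01 divr_gt0.
have d1 : d <= 1 by rewrite ge_min lexx.
have de : d * (2 + 2 * K) <= e by rewrite -ler_pdivlMr// ge_min lexx orbT.
have [u [r [Eu rd ul]]] := lE d d0.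
apply: filterS2 Eu vM => t vu vt.
have a0 := normr_ge0 (v t - u); have b0 := normr_ge0 (u - l).
have vuK : `|v t - u| <= K.
  have -> : v t - u = v t - l - (u - l) by rewrite opprB addrA subrK.
  apply: le_trans (ler_normB _ _) _.
  have := ler_normB (v t) l; rewrite /K; move: ul vt d1; lra.
have vl : `|v t - l| <= `|v t - u| + `|u - l|.
  by rewrite -(subrKA u (v t)) ler_normD.
have : `|v t - l| ^+ 2 <= (`|v t - u| + `|u - l|) ^+ 2.
  by rewrite ler_pXn2r ?nnegrE ?addr_ge0.
have h1 : `|v t - u| * `|u - l| <= K * d by apply: ler_pM => //; exact: ltW.
have h2 : `|u - l| * `|u - l| <= 1 * d.
  by apply: ler_pM => //; [exact: le_trans (ltW ul) d1|exact: ltW].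
move: h1 h2 vu rd de; rewrite !expr2; lra.
Qed.

(** Opial's lemma, with asymptotic centres in place of weak cluster points.
    Let [l] be the centre along [F].  If [dot h (v t - l) >= e] held
    frequently, then along the filter [G] of those [t] the point [l + s *: h]
    with [s] small would be strictly better than [l]; the centre [l'] along [G]
    would then be strictly closer to [v] than [l] along [G], hence along [F]
    because the distance to [l'] converges along [F], against the choice of
    [l]. *)
Lemma opial F v (S : set H) (M : R) : ProperFilter F ->
  (\forall t \near F, `|v t| <= M) ->
  (forall z, S z -> exists d : R, `|v t - z| ^+ 2 @[t --> F] --> d) ->
  (forall G l rho, ProperFilter G -> F `<=` G -> asymptotic_center G v l rho -> S l) ->
  exists2 l, S l & forall h, dot h (v t - l) @[t --> F] --> 0.
Proof.
move=> FF vM vS centerS.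
have [l [rho [lmin lrho]]] := asymptotic_center_exists FF vM.
have Sl : S l by apply: (centerS F l rho).
exists l => //.
suff main h e : 0 < e -> \forall t \near F, dot h (v t - l) < e.
  move=> h; apply/cvgrPdistC_lt => e e0.
  have h1 := main h e e0; have h2 := main (- h) e e0.
  apply: filterS2 h1 h2 => t; rewrite dotNl subr0 ltr_norml; lra.
move=> e0; apply: contrapT => nF.
pose D := [set t | e <= dot h (v t - l)].
have FG : F `<=` within D F by move=> A; apply: filterS.
have PG : ProperFilter (within D F).
  apply: Build_ProperFilter; rewrite /within /= => FD.
  apply: nF; apply: filterS FD => t Dt.
  by rewrite ltNge; apply/negP => /Dt.
have [l' [rho' c']] := asymptotic_center_exists PG (FG _ vM).
have Sl' := centerS _ _ _ PG FG c'; have [lmin' lrho'] := c'.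
have [d' vd'] := vS _ Sl'.
(* With this step [s ^+ 2 * `|h| ^+ 2 <= s * e], so that moving from [l] to
   [l + s *: h] gains at least [s * e]; the errors add up to at most half
   of it. *)
pose s := e / (`|h| ^+ 2 + 1).
have h1 : 0 < `|h| ^+ 2 + 1 by rewrite ltr_wpDl// sqr_ge0.
have s0 : 0 < s by rewrite divr_gt0.
have sh : s * (`|h| ^+ 2 + 1) = e by rewrite /s divfK ?gt_eqF.
have e80 : 0 < s * e / 8 by rewrite divr_gt0// mulr_gt0.
set d := s * e / 8 in e80.
move/cvgrPdistC_le: vd' => /(_ d e80) vd'.
have i1 : rho <= d' + d.
  by apply: (lmin l'); apply: filterS vd' => t; rewrite ler_norml; lra.
have i2 : d' <= rho' + 2 * d.
  have [t [a b]] := filter_ex (filterI (lrho' d e80) (FG _ vd')).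
  by move: b a; rewrite ler_norml; lra.
have i3 : rho' <= rho + d - 2 * s * e + s ^+ 2 * `|h| ^+ 2.
  apply: (lmin' (l + s *: h)).
  have : \forall t \near within D F, D t by apply: withinT.
  apply: filterS2 (FG _ (lrho d e80)) => t vl Dt.
  rewrite opprD addrA (sqr_normB hdot) normrZ exprMn real_normK ?num_real// dotZr (dotC dot _ h).
  have := ler_wpM2l (ltW s0) Dt; move: vl; lra.
have i4 : s ^+ 2 * `|h| ^+ 2 <= s * e.
  by rewrite -sh expr2 -mulrA ler_wpM2l ?(ltW s0)// ler_wpM2l ?(ltW s0)// lerDl.
have dE : s * e = 8 * d by rewrite /d; field.
move: i1 i2 i3 i4; rewrite -[2 * s * e]mulrA dE; lra.
Qed.

End weak_convergence.

Section weak_convergence_of_the_flow.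
Variables (R : realType) (H : completeNormedModType R).
Variables (dot : {dot H for idfun}) (hdot : induces_norm dot).
Variables (f : H -> R) (s0 lambda c : R) (x y w v : R -> H).
Hypotheses (f_convex : convex_function setT f) (f_diff : forall z, differentiable f z).
Hypotheses (s0_gt0 : 0 < s0) (lambda_gt0 : 0 < lambda) (c_gt0 : 0 < c).
Hypothesis F : newton_flow dot f s0 lambda c x y w v.
Variables (z : H) (z_min : argmin f z).

(** If [f l > f z], the gradient [g] of [f] at [l] separates: as [f (y s)]
    tends to [f z], convexity keeps [dot g (v s - l)] below a negative
    constant, so that moving from [l] in the direction [- g] lowers the
    asymptotic distance. *)
Lemma flow_center_argmin (G : set_system R) l rho : ProperFilter G ->
  +oo `<=` G -> asymptotic_center G v l rho -> argmin f l.
Proof.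
move=> PG FG [lmin lrho].
suff fl : f l <= f z by move=> u; apply: le_trans fl _; exact: z_min.
rewrite leNgt; apply/negP => flz.
set g := gradient dot f l.
pose B := `|v s0 - z|; have B0 : 0 <= B by exact: normr_ge0.
pose d := f l - f z; have d0 : 0 < d by rewrite subr_gt0.
have cw : `|w s| * (B + `|g| / lambda) @[s --> +oo] --> 0.
  rewrite -[X in _ --> X](mul0r (B + `|g| / lambda)).
  apply: cvgM; last exact: cvg_cst.
  exact: (norm_w_cvg0 hdot f_convex f_diff s0_gt0 lambda_gt0 c_gt0 F z_min).
have d20 : 0 < d / 2 by rewrite divr_gt0.
have gv : \forall s \near +oo, dot g (v s - l) <= - (d / 2).
  move/cvgrPdistC_le: cw => /(_ _ d20) cw.
  near=> s; have s0s : s0 <= s by near: s; exact: nbhs_pinfty_ge (num_real _).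
  have : `| `|w s| * (B + `|g| / lambda) - 0| <= d / 2 by near: s.
  rewrite subr0 ger0_norm; last first.
    by rewrite mulr_ge0// addr_ge0// divr_ge0// ltW.
  have h1 := convex_gradient_le hdot (y s) f_convex (f_diff l).
  have h2 : f (y s) <= envelope f lambda y w s.
    by rewrite /envelope lerDl mulr_ge0// invr_ge0 mulr_ge0// ltW.
  have h3 := flow_dist_ge hdot f_convex f_diff lambda_gt0 F z s.
  have h4 : dot (w s) (v s - z) <= `|w s| * B.
    apply: le_trans (dot_le hdot _ _) _; rewrite ler_wpM2l//.
    exact: (flow_dist_nonincreasing hdot f_convex f_diff s0_gt0 lambda_gt0 c_gt0 F z_min).
  have h5 : lambda^-1 * dot g (w s) <= `|w s| * (`|g| / lambda).
    have -> : `|w s| * (`|g| / lambda) = lambda^-1 * (`|g| * `|w s|) by ring.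
    by rewrite ler_wpM2l ?(dot_le hdot)// invr_ge0 ltW.
  have h6 : dot g (v s - l) = dot g (y s - l) + lambda^-1 * dot g (w s).
    by rewrite (flow_v F) !dotE; ring.
  rewrite h6 mulrDr; move: h1 h2 h3 h4 h5; rewrite -/g /d; lra.
have G0 : 0 < `|g| ^+ 2 + 1 by rewrite ltr_wpDl// sqr_ge0.
pose t := d / 2 / (`|g| ^+ 2 + 1).
have t0 : 0 < t by rewrite divr_gt0.
have tg : t * (`|g| ^+ 2 + 1) = d / 2 by rewrite /t divfK ?gt_eqF.
have td0 : 0 < t * d / 4 by rewrite divr_gt0// mulr_gt0.
have : rho <= rho + t * d / 4 - t * d + t ^+ 2 * `|g| ^+ 2.
  apply: (lmin (l - t *: g)).
  apply: filterS2 (lrho _ td0) (FG _ gv) => s vl gvs.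
  rewrite opprB addrCA addrC (sqr_normD hdot) normrZ exprMn real_normK ?num_real//.
  rewrite dotZr (dotC dot _ g).
  have := ler_wpM2l (ltW t0) gvs; move: vl; lra.
have : t ^+ 2 * `|g| ^+ 2 <= t * (d / 2).
  by rewrite -tg expr2 -mulrA ler_wpM2l ?(ltW t0)// ler_wpM2l ?(ltW t0)// lerDl.
move: td0; lra.
Unshelve. all: by end_near. Qed.

Lemma flow_weakly_cvg : exists2 l, weakly_cvg_to +oo x l & argmin f l.
Proof.
have [|||l lmin vl] := @opial R H dot hdot R +oo v (argmin f) (`|v s0 - z| + `|z|).
- near=> s; have s0s : s0 <= s by near: s; exact: nbhs_pinfty_ge (num_real _).
  rewrite -(subrK z (v s)); apply: le_trans (ler_normD _ _) _; rewrite lerD2r.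
  exact: (flow_dist_nonincreasing hdot f_convex f_diff s0_gt0 lambda_gt0 c_gt0 F z_min).
- move=> u umin.
  have [d _ hd] := flow_dist_cvg hdot f_convex f_diff s0_gt0 lambda_gt0 c_gt0 F umin.
  by exists d.
- by move=> G l rho PG FG; exact: flow_center_argmin.
exists l => // phi cphi; have [g phiE] := riesz_representation hdot cphi.
have xv : dot g (x s - v s) @[s --> +oo] --> 0.
  have xv0 : x s - v s @[s --> +oo] --> (0 : H).
    apply/cvgrPdistC_le => e e0.
    have cxv := flow_x_v_cvg0 hdot f_convex f_diff s0_gt0 lambda_gt0 c_gt0 F z_min.
    move/cvgrPdistC_le: cxv => /(_ e e0).
    by apply: filterS => s; rewrite !subr0 normr_id.
  by rewrite -(linear0r dot g); exact: (cvg_dot hdot (cvg_cst g) xv0).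
rewrite phiE.
have -> : (fun s => phi (x s)) = (fun s => dot g (v s - l) + dot g (x s - v s) + dot g l).
  by apply/funext => s; rewrite phiE !dotE; ring.
rewrite -[X in _ --> X]add0r -[X in X + _]addr0.
by apply: cvgD; [apply: cvgD => //; exact: vl|exact: cvg_cst].
Unshelve. all: by end_near. Qed.

End weak_convergence_of_the_flow.

Theorem theorem6 (R : realType) (H : completeNormedModType R)
    (dot : {dot H for idfun}) (hdot : induces_norm dot)
    (f : H -> R)
    (f_convex : convex_function setT f)
    (f_C1 : class_C1 f)
    (S_nonempty : argmin f !=set0)
    (gradf_lipschitz : forall B : set H, bounded_set B ->
      [lipschitz gradient dot f y | y in B])
    (s0 lambda alpha : R)
    (s0_gt0 : 0 < s0) (lambda_gt0 : 0 < lambda) (alpha_gt1 : 1 < alpha)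
    (x dx w : R -> H)
    (x_sol : strong_solution dot f s0 lambda alpha x dx w) :
  [/\ (\int[@lebesgue_measure R]_(s in `[s0, +oo[) (s ^+ 3 * `|w s| ^+ 2)%:E
        < +oo)%E,
      (fun s : R => `|w s|) =o_+oo (fun s : R => 1 / s ^+ 2),
      (fun s : R => `|dx s|) =o_+oo (fun s : R => 1 / s),
      exists2 l : H, weakly_cvg_to +oo x l & argmin f l &
      3 < alpha ->
        (fun s : R => f (x s) - inf (range f)) =o_+oo
        (fun s : R => 1 / s ^+ 2)].
Proof.
have [z z_min] := S_nonempty.
have f_diff : forall u, differentiable f u := f_C1.1.
have c_gt0 : 0 < alpha - 1 by rewrite subr_gt0.
have [y [w' [v [F wdx]]]] :=
  strong_solution_newton_flow hdot gradf_lipschitz s0_gt0 lambda_gt0 alpha_gt1 x_sol.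
split.
- have := flow_integral_lty hdot f_convex f_diff s0_gt0 lambda_gt0 c_gt0 F z_min.
  suff -> : (\int[@lebesgue_measure R]_(s in `[s0, +oo[) (s ^+ 3 * `|w' s| ^+ 2)%:E =
    \int[@lebesgue_measure R]_(s in `[s0, +oo[) (s ^+ 3 * `|w s| ^+ 2)%:E)%E by [].
  apply: eq_integral => s; rewrite inE /= in_itv /= andbT => s0s.
  by have [-> _] := wdx s s0s.
- apply: cvg0_littleo.
  apply: cvg_trans (flow_norm_w_rate hdot f_convex f_diff s0_gt0 lambda_gt0 c_gt0 F z_min).
  apply: near_eq_cvg; near=> s.
  have s0s : s0 <= s by near: s; exact: nbhs_pinfty_ge (num_real _).
  by have [-> _] := wdx s s0s.
- apply: (@cvg0_littleo _ _ 1).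
  apply: cvg_trans (flow_velocity_rate hdot f_convex f_diff s0_gt0 lambda_gt0 c_gt0 F z_min).
  apply: near_eq_cvg; near=> s.
  have s0s : s0 <= s by near: s; exact: nbhs_pinfty_ge (num_real _).
  by have [_ ->] := wdx s s0s.
- exact: (flow_weakly_cvg hdot f_convex f_diff s0_gt0 lambda_gt0 c_gt0 F z_min).
- move=> alpha3; apply: cvg0_littleo.
  have -> : inf (range f) = f z.
    apply/eqP; rewrite eq_le; apply/andP; split.
      by apply: ge_inf; [exists (f z) => _ [u _ <-]; exact: z_min|exists z].
    apply: lb_le_inf; first by exists (f z), z.
    by move=> _ [u _ <-]; exact: z_min.
  apply: (flow_value_rate hdot f_convex f_diff s0_gt0 lambda_gt0 c_gt0 F z_min).
  by move: alpha3; lra.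
Unshelve. all: by end_near. Qed.
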